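(* Let $S,T\subset\mathbb{R}^n$ be disjoint closed sets. Then $H_S\cap H_T=\{0\}$.
   Context: Fix $n\ge 1$ and $m>0$, and let $E(\vec p)=\sqrt{|\vec p|^2+m^2}$ for $\vec p\in\mathbb{R}^n$. Let $L^2_r(\mathbb{R}^n)=L^2(\mathbb{R}^n,d\vec p/E(\vec p))$, with norm $\|\phi\|_r=\left(\int|\phi(\vec p)|^2\,\frac{d\vec p}{E(\vec p)}\right)^{1/2}$; note $L^2(\mathbb{R}^n)\subset L^2_r(\mathbb{R}^n)$. The Fourier transform is normalized to be unitary on $L^2(\mathbb{R}^n)$, $\hat\psi(\vec p)=(2\pi)^{-n/2}\int e^{-\mathrm{i}\vec p\cdot\vec x}\psi(\vec x)\,d\vec x$. For measurable $S\subset\mathbb{R}^n$, $L^2(S)$ is the set of functions in $L^2(\mathbb{R}^n)$ vanishing almost everywhere off $S$, and $H_S\subset L^2_r(\mathbb{R}^n)$ is the closure, with respect to $\|\cdot\|_r$, of $\{\hat\psi:\psi\in L^2(S)\}$. *)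

(* Defs.v *)
From HB Require Import structures.
From mathcomp Require Import all_boot all_order all_algebra.
From mathcomp Require Import all_classical all_reals all_analysis.
From mathcomp Require Import complex.

Set Implicit Arguments.
Unset Strict Implicit.
Unset Printing Implicit Defensive.
Import Order.TTheory GRing.Theory Num.Theory.
Import numFieldNormedType.Exports.

Local Open Scope classical_set_scope.
Local Open Scope ring_scope.

(* R^n is ['rV[R]_n], with the library's topology (that of the sup norm, which
   is the Euclidean topology) and the sigma-algebra generated by the
   coordinates, as the library does for tuples; over the reals this is the
   Borel sigma-algebra. *)
Section measurable_rV.
Context {d : measure_display} {T : measurableType d} (n : nat).

Let coord : 'I_n -> 'rV[T]_n -> T := fun i v => v ord0 i.

Let rV_set0 : g_sigma_preimage coord set0.
Proof. exact: sigma_algebra0. Qed.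

Let rV_setC A : g_sigma_preimage coord A -> g_sigma_preimage coord (~` A).
Proof. exact: sigma_algebraC. Qed.

Let rV_bigcup (F : _^nat) : (forall i, g_sigma_preimage coord (F i)) ->
  g_sigma_preimage coord (\bigcup_i (F i)).
Proof. exact: sigma_algebra_bigcup. Qed.

HB.instance Definition _ := @isMeasurable.Build (measure_tuple_display d)
  'rV[T]_n (g_sigma_preimage coord) rV_set0 rV_setC rV_bigcup.

End measurable_rV.

Lemma measurable_coord d (T : measurableType d) n (i : 'I_n) :
  measurable_fun [set: 'rV[T]_n] (fun v => v ord0 i).
Proof.
move=> _ Y mY; rewrite setTI; apply: sub_sigma_algebra => /=.
rewrite -bigcup_seq/=; exists i => /=; first by rewrite mem_index_enum.
by exists Y => //; rewrite setTI.
Qed.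

Lemma measurable_fun_rV d1 d2 (T1 : measurableType d1)
    (T2 : measurableType d2) n (f : T1 -> 'rV[T2]_n) :
  (forall i, measurable_fun [set: T1] (fun x => f x ord0 i)) ->
  measurable_fun [set: T1] f.
Proof.
move=> mf.
suff H : g_sigma_preimage (fun (i : 'I_n) (v : 'rV[T2]_n) => v ord0 i) `<=`
    [set A | measurable (f @^-1` A)].
  by move=> _ A mA; rewrite setTI; exact: H.
apply: smallest_sub.
  split=> /=.
  - by rewrite preimage_set0.
  - move=> A mA; rewrite setTD -[X in measurable X]/(~` (f @^-1` A)).
    exact: measurableC.
  - by move=> F mF; rewrite preimage_bigcup; exact: bigcupT_measurable.
move=> A; rewrite -bigcup_seq/= => -[i _ [B mB <-]].
rewrite setTI -[X in measurable X]setTI.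
by apply: mf.
Qed.

Section cons_rV.
Context (R : realType) (n : nat).

Definition cons_rV (z : measurableTypeR R * 'rV[R]_n) : 'rV[R]_n.+1 :=
  \row_i oapp (z.2 ord0) (z.1 : R) (unlift ord0 i).

Lemma measurable_cons_rV : measurable_fun setT cons_rV.
Proof.
apply: measurable_fun_rV => i.
under eq_fun do rewrite mxE.
case: unliftP => [j _|_] /=; last exact: measurable_fst.
exact: (measurableT_comp (measurable_coord j) measurable_snd).
Qed.

Variable nu : {sigma_finite_measure set 'rV[R]_n -> \bar R}.

Definition cons_leb : set 'rV[R]_n.+1 -> \bar R :=
  pushforward (@lebesgue_measure R \x nu)%E cons_rV.

HB.instance Definition _ := Measure.copy cons_leb
  (measure_function_pushforward__canonical__measure_function_Measure
    (product_measure1 (@lebesgue_measure R) nu) measurable_cons_rV).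

Let cons_leb_sigma_finite : sigma_finite setT cons_leb.
Proof.
have /sigma_finiteP[F [TF ndF Foo]] := sigma_finiteT (@lebesgue_measure R).
have /sigma_finiteP[G [TG ndG Goo]] := sigma_finiteT nu.
pose g (v : 'rV[R]_n.+1) : measurableTypeR R * 'rV[R]_n :=
  (v ord0 ord0, \row_i v ord0 (lift ord0 i)).
have mg : measurable_fun setT g.
  apply: measurable_fun_pair; first exact: measurable_coord.
  apply: measurable_fun_rV => i; under eq_fun do rewrite mxE.
  exact: measurable_coord.
have consK : cancel (cons_rV) g.
  move=> [x v]; rewrite /g /cons_rV mxE unlift_none /=; congr pair.
  by apply/rowP => i; rewrite !mxE liftK.
exists (fun k => g @^-1` (F k `*` G k)).
  apply/esym; rewrite -subTset => v _.
  have [i _ Fi] : (\bigcup_k F k) (g v).1 by rewrite -TF.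
  have [j _ Gj] : (\bigcup_k G k) (g v).2 by rewrite -TG.
  exists (maxn i j) => //; split.
  - by move: Fi; exact/subsetPset/ndF/leq_maxl.
  - by move: Gj; exact/subsetPset/ndG/leq_maxr.
move=> k; have [mF Fk] := Foo k; have [mG Gk] := Goo k.
have mFG : measurable (F k `*` G k) by exact: measurableX.
split; first by rewrite -[X in measurable X]setTI; exact: mg.
rewrite /cons_leb /pushforward -comp_preimage (_ : g \o _ = id); last first.
  by apply/funext => z /=; rewrite consK.
by rewrite preimage_id product_measure1E// lte_mul_pinfty// ge0_fin_numE.
Qed.

HB.instance Definition _ := Measure_isSigmaFinite.Build _ _ _ cons_leb
  cons_leb_sigma_finite.

End cons_rV.

Fixpoint lebesgue_rV (R : realType) (n : nat) :
    {sigma_finite_measure set 'rV[R]_n -> \bar R} :=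
  match n with
  | 0 => \d_(0 : 'rV[R]_0)
  | k.+1 => cons_leb (lebesgue_rV R k)
  end.
Arguments lebesgue_rV {R n}.

(* This property characterizes Lebesgue measure on R^n. *)
Lemma lebesgue_rV_box (R : realType) (n : nat) (a b : 'rV[R]_n) :
  (forall i, a ord0 i <= b ord0 i) ->
  lebesgue_rV [set v : 'rV[R]_n | forall i, v ord0 i \in `]a ord0 i, b ord0 i]]
  = (\prod_i (b ord0 i - a ord0 i))%:E.
Proof.
elim: n a b => [|n IHn] a b ab.
  by rewrite big_ord0 /= diracE mem_set// => -[].
pose tl (v : 'rV[R]_n.+1) : 'rV[R]_n := \row_i v ord0 (lift ord0 i).
pose B := [set v : 'rV[R]_n |
  forall i, v ord0 i \in `](tl a) ord0 i, (tl b) ord0 i]].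
have mB : measurable B.
  rewrite (_ : B = \bigcap_(i in [set: 'I_n])
      (setT `&` (fun v : 'rV[R]_n => v ord0 i) @^-1`
        `](tl a) ord0 i, (tl b) ord0 i])).
    apply: fin_bigcap_measurable => [|i _]; first exact: finite_finset.
    exact: measurable_coord.
  apply/seteqP; split => [v Bv i _|v Bv i]; first by split=> //; exact: Bv.
  by have [] := Bv i I.
rewrite big_ord_recl EFinM -[LHS]/((lebesgue_measure \x lebesgue_rV)%E _).
rewrite [X in (_ \x _)%E X](_ : _ = `]a ord0 ord0, b ord0 ord0] `*` B);
    last first.
  apply/seteqP; split => [[x v] /= H|[x v] /= [Hx Hv] i].
    split => [|i]; first by have := H ord0; rewrite mxE unlift_none.
    by have := H (lift ord0 i); rewrite !mxE liftK.
  rewrite mxE; case: unliftP => [j ->|->] //=.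
  by have := Hv j; rewrite !mxE.
rewrite product_measure1E//=; congr (_ * _)%E.
  rewrite lebesgue_measure_itv /= lte_fin lt_neqAle ab andbT.
  by case: eqP => [->|_] //=; rewrite subrr.
rewrite IHn => [|i]; last by rewrite !mxE.
by congr EFin; apply: eq_bigr => i _; rewrite !mxE.
Qed.

Section wavefunctions.
Context (R : realType) (n : nat).
Local Notation Rn := 'rV[R]_n.
Local Notation leb := (@lebesgue_rV R n).
Implicit Types (f psi phi chi : Rn -> R[i]) (x p : Rn) (S : set Rn).

Definition dotprod p x : R := \sum_i p ord0 i * x ord0 i.

(* Functions are not quotiented by a.e. equality: elements of the L^p spaces
   below are honest functions.  Measurability is Borel measurability; every
   Lebesgue class has a Borel representative. *)
Definition cmeasurable f : Prop :=
  measurable_fun setT (fun x => complex.Re (f x)) /\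
  measurable_fun setT (fun x => complex.Im (f x)).

Definition cLnorm (q : R) f : \bar R :=
  'N[leb]_(q%:E)[EFin \o (@Normc.normc R \o f)].

Definition cLp (q : R) : set (Rn -> R[i]) :=
  [set f | cmeasurable f /\ (cLnorm q f < +oo)%E].

Definition cLp_on (q : R) S : set (Rn -> R[i]) :=
  [set f | cLp q f /\ {ae leb, forall x, ~ S x -> f x = 0}].

Definition cintegral f : R[i] :=
  (\int[leb]_x complex.Re (f x) +i* \int[leb]_x complex.Im (f x))%C.

Definition cis (t : R) : R[i] := (cos t +i* sin t)%C.

(* The unitary normalization, with the integral over R^n absolutely convergent
   for psi in L^1. *)
Definition fourier_integral psi : Rn -> R[i] := fun p =>
  (((2 * pi) `^ (- (n%:R / 2)))%:C)%C *
  cintegral (fun x => cis (- dotprod p x) * psi x).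

(* [is_fourier psi phi]: phi is (a representative of) the Fourier transform of
   psi in L^2, i.e. the value at psi of the L^2-continuous extension of
   [fourier_integral] from the dense subspace of L^1 /\ L^2. *)
Definition is_fourier psi phi : Prop :=
  [/\ cLp 2 psi, cLp 2 phi &
    exists u : nat -> Rn -> R[i],
      [/\ forall k, cLp 1 (u k) /\ cLp 2 (u k),
          cLnorm 2 (fun x => u k x - psi x) @[k --> \oo] --> 0%E &
          cLnorm 2 (fun p => fourier_integral (u k) p - phi p)
            @[k --> \oo] --> 0%E]].

Definition energy (m : R) p : R := Num.sqrt (dotprod p p + m ^+ 2).

Definition rnorm (m : R) phi : \bar R :=
  ((\int[leb]_p (Normc.normc (phi p) ^+ 2 / energy m p)%:E) `^ 2^-1)%E.

Definition L2r (m : R) : set (Rn -> R[i]) :=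
  [set phi | cmeasurable phi /\ (rnorm m phi < +oo)%E].

Definition rclosure (m : R) (A : set (Rn -> R[i])) : set (Rn -> R[i]) :=
  [set phi | L2r m phi /\ forall e : R, 0 < e ->
    exists2 chi, A chi & (rnorm m (fun p => (phi p - chi p)%R) < e%:E)%E].

Definition Hspace (m : R) S : set (Rn -> R[i]) :=
  rclosure m [set chi | exists2 psi, cLp_on 2 S psi & is_fourier psi chi].

(* The a.e. class of 0, i.e. the zero element of L^2_r. *)
Definition zero_class : set (Rn -> R[i]) :=
  [set phi | cmeasurable phi /\ {ae leb, forall p, phi p = 0}].

End wavefunctions.

(* Main.v *)
Require Import Defs.
From mathcomp Require Import all_boot all_order all_algebra.
From mathcomp Require Import all_classical all_reals all_analysis.
From mathcomp Require Import measurable_realfun complex ring lra.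
Import Order.TTheory GRing.Theory Num.Theory.
Import numFieldNormedType.Exports.
Local Open Scope classical_set_scope.
Local Open Scope ring_scope.

(* A function phi in H_S is tested against e^(i c.p) w_r(p), where w_r is a
   product of Fejer kernels, i.e. the Fourier transform of a product of hat
   functions supported in a cube of half-width r.  If the cube around c misses S,
   the pairing vanishes on the transforms of L^2(S) (multiplication formula) and
   hence on H_S by continuity.  The support of the transform of w_r is found
   without Fourier inversion: the integral of (1 - cos (s x)) / x^2 is
   proportional to |s|, and (1 - cos (r x)) cos (y x) is a combination of such
   terms.  Since w_(2r) is a trigonometric polynomial times w_r, the pairing at
   scale 2r is a combination of pairings at scale r with nearby centers; when
   phi is in both H_S and H_T, bisection down to cubes so small that they miss S
   or miss T shows that all pairings vanish.  Then phi w_r is an integrable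
   function with zero Fourier transform, so it is 0 almost everywhere: trigonometric
   functions generate all indicators of measurable sets under linear
   combinations and bounded pointwise limits. *)

(** An element of L^2_r need not be square integrable, so on the position side it is in general only
    a distribution, and lying in H_S gives no pointwise statement there. The pairings replace it:
    they must be continuous for the norm with weight 1/E, which amounts to integrability of w_r^2 E.
    This dictates the kernel. E(p) is at most a constant times the product of the 1 + |p_i|, and the
    square of a Fejer kernel decays like x^-4, so the product kernel works in every dimension; the
    transform of the indicator of an interval, of order 1/x, would just fail. Disjoint closed sets
    may come arbitrarily close to each other at infinity, so no uniform gap between S and T is
    available; bisection only uses the gap between a single limit point and whichever of the two
    sets misses it. Complex exponentials are handled through real integrals with a free phase t, and
    the same phase carries the inductions over coordinates. *)

Section fejer_kernel.
Context {R : realType}.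
Local Notation mu := (@lebesgue_measure R).
Implicit Types (r s x y t : R).

(** Inversion is not continuous at 0, so it is written as x times a real power of the nonnegative
    number x^2; at 0 both sides are 0 by the convention [invr0]. *)
Lemma measurable_invr : measurable_fun setT (@GRing.inv R).
Proof.
rewrite [X in measurable_fun _ X](_ : _ = (fun x => x * (x ^+ 2) `^ (-1))).
  apply: measurable_funM => //.
  apply: (@measurableT_comp _ _ _ _ _ _ (@powR R ^~ (-1)) _ (fun x => x ^+ 2)).
    exact: measurable_powR.
  exact: exprn_measurable.
apply/funext => x; have [->|x0] := eqVneq x 0; first by rewrite invr0 mul0r.
by rewrite powR_inv1 ?sqr_ge0// expr2 invfM mulrA divff// mul1r.
Qed.

Lemma measurable_cos : measurable_fun setT (@cos R).
Proof. by apply: continuous_measurable_fun; exact: continuous_cos. Qed.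

Lemma measurable_sin : measurable_fun setT (@sin R).
Proof. by apply: continuous_measurable_fun; exact: continuous_sin. Qed.

Lemma onemcos x : 1 - cos x = 2 * sin (x / 2) ^+ 2.
Proof.
have {1}-> : x = (x / 2) *+ 2 by rewrite -mulr_natr divfK.
rewrite cos_mulr2n cos2sin2; ring.
Qed.

Lemma sin_le_id x : 0 <= x -> sin x <= x.
Proof.
move=> x0; have [|c _] := @MVT_segment R sin cos 0 x x0 (fun _ _ => is_derive_sin _).
  by apply: continuous_subspaceT; exact: continuous_sin.
rewrite sin0 !subr0 => ->; rewrite ler_piMl//; exact: cos_le1.
Qed.

Lemma sqr_sin_le x : sin x ^+ 2 <= x ^+ 2.
Proof.
have : `|sin x| <= `|x|; last by move=> ?; rewrite -(real_normK (num_real (sin x)))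
  -(real_normK (num_real x)) lerXn2r ?nnegrE.
rewrite ler_norml; have p2 := pi_ge2 R; have [x0|x0] := leP 0 x.
  rewrite (ger0_norm x0); have h := sin_le_id x x0; apply/andP; split => //.
  have [x1|x1] := leP x 1; last by have := sin_geN1 x; lra.
  suff : 0 <= sin x by lra.
  by apply: sin_ge0_pi; lra.
rewrite (ltr0_norm x0) opprK; have : sin (- x) <= - x by apply: sin_le_id; lra.
rewrite sinN lerN2 => h; apply/andP; split => //.
have [x1|x1] := leP (- 1) x; last by have := sin_le1 x; lra.
suff : 0 <= sin (- x) by rewrite sinN; lra.
by apply: sin_ge0_pi; lra.
Qed.

Lemma onemcos_ge0 x : 0 <= 1 - cos x.
Proof. by rewrite subr_ge0 cos_le1. Qed.

Lemma onemcos_le_sqr x : 1 - cos x <= x ^+ 2.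
Proof. rewrite onemcos; have := sqr_sin_le (x / 2); have := sqr_ge0 x; lra. Qed.

(* Takes the junk value [0] at [x = 0]. *)
Definition fejer_raw r x : R := (1 - cos (r * x)) / x ^+ 2.

(* [fejer r] is continuous; up to scaling it is the Fourier transform of the
   hat function supported on [-r, r]. *)
Definition fejer r x : R := fejer_raw r x + (r ^+ 2 / 2) * (x == 0)%:R.

(** Common integrable majorant, up to a constant, of all Fejer kernels. *)
Definition invD1sqr x : R := (1 + x ^+ 2)^-1.

Lemma invD1sqr_gt0 x : 0 < invD1sqr x.
Proof. by rewrite invr_gt0 ltr_pwDl// sqr_ge0. Qed.

Lemma measurable_invD1sqr : measurable_fun setT invD1sqr.
Proof.
by apply: (measurableT_comp measurable_invr); exact: measurable_funD.
Qed.

Lemma measurable_fejer_raw r : measurable_fun setT (fejer_raw r).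
Proof.
apply: measurable_funM.
  apply: measurable_funB => //; apply: (measurableT_comp measurable_cos).
  exact: measurable_funM.
by apply: (measurableT_comp measurable_invr); exact: exprn_measurable.
Qed.

Lemma measurable_fejer r : measurable_fun setT (fejer r).
Proof.
apply: measurable_funD; first exact: measurable_fejer_raw.
apply: measurable_funM => //.
rewrite [X in measurable_fun _ X](_ : _ = \1_[set 0]).
  exact: measurable_indic.
apply/funext => x; rewrite indicE; congr ((nat_of_bool _)%:R).
by apply/idP/idP; rewrite inE => /eqP.
Qed.

Lemma fejer_raw_ge0 r x : 0 <= fejer_raw r x.
Proof. by rewrite divr_ge0 ?sqr_ge0 ?onemcos_ge0. Qed.

Lemma fejer_ge0 r x : 0 <= fejer r x.
Proof. by rewrite addr_ge0 ?fejer_raw_ge0// mulr_ge0// divr_ge0 ?sqr_ge0. Qed.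

Lemma fejer_at0 r : fejer r 0 = r ^+ 2 / 2.
Proof. by rewrite /fejer /fejer_raw mulr0 cos0 subrr mul0r add0r eqxx mulr1. Qed.

Lemma fejer_neq0 r x : x != 0 -> fejer r x = fejer_raw r x.
Proof. by move=> x0; rewrite /fejer (negbTE x0) mulr0 addr0. Qed.

(** From 1 - cos (2u) = 2 (1 + cos u) (1 - cos u). On the Fourier side, the hat of half-width 2r is
    the sum of the hats of half-width r centered at -r, 0 and r, with weights 1, 2, 1. *)
Lemma fejer_double r x : fejer (2 * r) x = (2 + 2 * cos (r * x)) * fejer r x.
Proof.
have [->|x0] := eqVneq x 0; first by rewrite !fejer_at0 mulr0 cos0; lra.
rewrite !fejer_neq0// /fejer_raw mulrA; congr (_ / _).
rewrite (_ : 2 * r * x = (r * x) *+ 2) ?cos_mulr2n//; ring.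
Qed.

Lemma fejer_le r x : fejer r x <= (r ^+ 2 + 2) * invD1sqr x.
Proof.
rewrite ler_pdivlMr ?ltr_pwDl ?sqr_ge0//.
have [->|x0] := eqVneq x 0.
  by rewrite fejer_at0 expr0n addr0 mulr1; have := sqr_ge0 r; lra.
have x2 : 0 < x ^+ 2 by rewrite exprn_even_gt0.
(* After multiplication by 1 + x^2, the quotient (1 - cos (r x)) / x^2 contributes at most r^2 and
   the numerator alone at most 2. *)
rewrite fejer_neq0// /fejer_raw mulrDr mulr1 divfK ?gt_eqF//.
rewrite lerD//; last by have := cos_geN1 (r * x); lra.
by rewrite ler_pdivrMr// -exprMn onemcos_le_sqr.
Qed.

Lemma integrable_invD1sqr : mu.-integrable setT (EFin \o invD1sqr).
Proof.
apply/integrableP; split; first by apply/measurable_EFinP; exact: measurable_invD1sqr.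
under eq_integral do rewrite /= ger0_norm ?ltW ?invD1sqr_gt0//.
rewrite ge0_symfun_integralT.
- rewrite -[X in integral _ X _]/([set x | 0 <= x]) -set_itvcy.
  by rewrite integral0y_oneDsqr -EFinM ltry.
- by move=> x; rewrite ltW ?invD1sqr_gt0.
- by move=> x; exact: continuous_oneDsqrV.
- by move=> x; rewrite /invD1sqr/= sqrrN.
Qed.

Lemma integrable_fejer_raw r : mu.-integrable setT (EFin \o fejer_raw r).
Proof.
apply: le_integrable (integrableZl measurableT (r ^+ 2 + 2) integrable_invD1sqr) => //.
- by apply/measurable_EFinP; exact: measurable_fejer_raw.
- move=> x _; rewrite lee_fin !ger0_norm ?fejer_raw_ge0//; last first.
    by rewrite mulr_ge0 ?(ltW (invD1sqr_gt0 _)) ?addr_ge0 ?sqr_ge0.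
  apply: le_trans (fejer_le r x); rewrite /fejer lerDl mulr_ge0//.
  by rewrite divr_ge0 ?sqr_ge0.
Qed.

(** By uniqueness of Lebesgue measure: the rescaled pushforward gives every half-open interval its
    length. *)
Lemma lebesgue_measureZ s (A : set R) : 0 < s -> measurable A ->
  (s%:E * pushforward mu ( *%R s : _ -> measurableTypeR R) A)%E = mu A.
Proof.
move=> s0 mA.
have ms : measurable_fun setT ( *%R s : measurableTypeR R -> measurableTypeR R).
  exact: measurable_funM.
pose nu := mscale (NngNum (ltW s0))
  (measure_function_pushforward__canonical__measure_function_Measure mu ms).
rewrite -[LHS]/(nu A); apply/esym/lebesgue_measure_unique => //= _ [[a b]] _ <-.
rewrite /nu /mscale/= /pushforward.
rewrite [X in (_ * mu X)%E](_ : _ = `]a / s, b / s]%classic); last first.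
  apply/seteqP; split => x /=; rewrite !in_itv/= ltr_pdivrMr// ler_pdivlMr//;
    by rewrite ![x * s]mulrC.
rewrite !lebesgue_measure_itv/= !lte_fin ltr_pM2r ?invr_gt0//.
case: ifPn => _; last by rewrite mule0.
by rewrite -EFinM mulrBr mulrCA divff ?gt_eqF// mulr1 mulrCA divff ?gt_eqF// mulr1.
Qed.

Lemma ge0_integralZ s (f : R -> R) : 0 < s -> measurable_fun setT f ->
  (forall x, 0 <= f x) ->
  (\int[mu]_x (f x)%:E = s%:E * \int[mu]_x (f (s * x)%R)%:E)%E.
Proof.
move=> s0 mf f0.
have ms : measurable_fun setT ( *%R s : measurableTypeR R -> measurableTypeR R).
  exact: measurable_funM.
pose P := (measure_function_pushforward__canonical__measure_function_Measure mu ms).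
have -> : (\int[mu]_x (f (s * x)%R)%:E = \int[P]_x (f x)%:E)%E.
  rewrite ge0_integral_pushforward//=; first by apply/measurable_EFinP.
  by move=> x _; rewrite lee_fin.
rewrite -[s]/((NngNum (ltW s0))%:num) -ge0_integral_mscale//; last 2 first.
- by apply/measurable_EFinP.
- by move=> x _; rewrite lee_fin.
by apply: eq_measure_integral => A mA _; exact/esym/lebesgue_measureZ.
Qed.

Lemma Rintegral_odd (f : R -> R) : mu.-integrable setT (EFin \o f) ->
  (forall x, f (- x) = - f x) -> \int[mu]_x f x = 0.
Proof.
move=> fi oddf.
have mN : measurable_fun setT (-%R : measurableTypeR R -> measurableTypeR R).
  exact: oppr_measurable.
pose P := (measure_function_pushforward__canonical__measure_function_Measure mu mN).
have mf : measurable_fun setT (EFin \o f) := measurable_int _ fi.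
suff : \int[mu]_x f x = - (\int[mu]_x f x) by lra.
have -> : - (\int[mu]_x f x) = \int[mu]_x (-1 * f x).
  by rewrite RintegralZl// mulN1r.
rewrite /Rintegral; congr fine.
transitivity (\int[P]_x (f x)%:E)%E.
  by apply: eq_measure_integral => A mA _; exact/esym/lebesgue_measureN.
rewrite integral_pushforward//=.
  by apply: eq_integral => x _ /=; rewrite oddf mulN1r.
rewrite preimage_setT; apply: eq_integrable (integrableZl measurableT (-1) fi) => //.
by move=> x _ /=; rewrite oddf -EFinM mulN1r.
Qed.

Lemma fejer_rawZ s x : fejer_raw 1 (s * x) = s ^- 2 * fejer_raw s x.
Proof. by rewrite /fejer_raw mul1r exprMn invfM mulrCA. Qed.

(** Substitution of s x for x, with evenness in s for negative s. The constant on the right is pi,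
    but only the dependence on |s| matters below. *)
Lemma Rintegral_fejer_raw s : \int[mu]_x fejer_raw s x = `|s| * \int[mu]_x fejer_raw 1 x.
Proof.
wlog s0 : s / 0 <= s.
  move=> H; have [/H //|s0] := leP 0 s.
  rewrite -normrN -H ?oppr_ge0 ?ltW//; apply: eq_Rintegral => x _.
  by rewrite /fejer_raw mulNr cosN.
move: s0; rewrite le_eqVlt => /predU1P[<-|s0].
  rewrite normr0 mul0r [LHS]Rintegral_mkcond.
  under eq_Rintegral do rewrite patchE in_setT /fejer_raw mul0r cos0 subrr mul0r.
  by rewrite /Rintegral integral0.
rewrite gtr0_norm// /Rintegral (ge0_integralZ s (fejer_raw 1))//.
- rewrite fineM//; last first.
    apply: integrable_fin_num => //.
    apply: eq_integrable (integrableZl measurableT (s ^- 2) (integrable_fejer_raw s)) => //.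
    by move=> x _ /=; rewrite fejer_rawZ EFinM.
  rewrite mulrA/= -/(Rintegral mu setT (fun x => fejer_raw 1 (s * x))).
  rewrite -expr2.
  under [in RHS]eq_Rintegral do rewrite fejer_rawZ.
  rewrite RintegralZl//; last exact: integrable_fejer_raw.
  by rewrite mulrA divff ?mul1r// expf_neq0// gt_eqF.
- exact: measurable_fejer_raw.
- exact: fejer_raw_ge0.
Qed.

Lemma integrable_fejer_rawM r (g : R -> R) : measurable_fun setT g ->
  (forall x, `|g x| <= 1) ->
  mu.-integrable setT (EFin \o (fun x => fejer_raw r x * g x)).
Proof.
move=> mg g1; apply: le_integrable (integrable_fejer_raw r) => //.
  by apply/measurable_EFinP/measurable_funM => //; exact: measurable_fejer_raw.
by move=> x _ /=; rewrite lee_fin normrM ler_piMr.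
Qed.

Lemma measurable_cosD y t : measurable_fun setT (fun x => cos (y * x + t)).
Proof.
apply: (measurableT_comp measurable_cos).
by apply: measurable_funD => //; exact: measurable_funM.
Qed.

(** The product-to-sum formula turns the integral into a multiple of (|r + y| + |r - y|) / 2 - |y|,
    a second difference of the absolute value, which vanishes because |.| is affine on
    [y - r, y + r] when r <= |y|. *)
Lemma Rintegral_fejer_raw_cos r y : 0 <= r <= `|y| ->
  \int[mu]_x (fejer_raw r x * cos (y * x)) = 0.
Proof.
move=> /andP[r0 ry].
have E x : fejer_raw r x * cos (y * x) =
    (2^-1 * fejer_raw (r + y) x + 2^-1 * fejer_raw (r - y) x) - fejer_raw y x.
  rewrite /fejer_raw [(r + y) * x]mulrDl [(r - y) * x]mulrBl cosD cosB.
  (* The factor [x ^- 2] is generalized so that [field] asks nothing about x = 0. *)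
  by move: (x ^- 2) => i; field.
under eq_Rintegral do rewrite E.
have i1 s : mu.-integrable setT (EFin \o (fun x => 2^-1 * fejer_raw s x)).
  exact: (integrableZl _ _ (integrable_fejer_raw s)).
rewrite RintegralB//; [|exact: (integrableD _ (i1 _) (i1 _))|exact: integrable_fejer_raw].
rewrite RintegralD// !RintegralZl//; try exact: integrable_fejer_raw.
rewrite !(Rintegral_fejer_raw (_ + _)) (Rintegral_fejer_raw y).
set C := Rintegral _ _ _.
have [y0|y0] := leP 0 y.
  move: ry; rewrite (ger0_norm y0) => ry.
  rewrite ger0_norm ?addr_ge0// ler0_norm ?subr_le0//; lra.
move: ry; rewrite (ltr0_norm y0) => ry.
rewrite ler0_norm; last lra.
rewrite ger0_norm; last lra.
lra.
Qed.

Lemma Rintegral_fejer_cosD r y t : 0 <= r <= `|y| ->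
  \int[mu]_x (fejer r x * cos (y * x + t)) = 0.
Proof.
move=> ry.
have mc : measurable_fun setT (fun x => cos (y * x)).
  by apply: (measurableT_comp measurable_cos); exact: measurable_funM.
have ms : measurable_fun setT (fun x => sin (y * x)).
  by apply: (measurableT_comp measurable_sin); exact: measurable_funM.
(* [fejer] and [fejer_raw] differ only at the null point 0. Expanding the cosine leaves an even
   part, already known to vanish, and an odd part. *)
have E : \int[mu]_x (fejer r x * cos (y * x + t)) =
    \int[mu]_x (cos t * (fejer_raw r x * cos (y * x)) -
                sin t * (fejer_raw r x * sin (y * x))).
  rewrite /Rintegral; congr fine.
  rewrite -[LHS](@integral_setD1 _ _ 0); last 2 first.
  - exact: measurableD.
  - apply/measurable_funTS/measurable_EFinP/measurable_funM.
      exact: measurable_fejer.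
    exact: measurable_cosD.
  rewrite -[RHS](@integral_setD1 _ _ 0); last 2 first.
  - exact: measurableD.
  - apply/measurable_funTS/measurable_EFinP.
    by apply: measurable_funB; apply: measurable_funM => //;
      apply: measurable_funM => //; exact: measurable_fejer_raw.
  apply: eq_integral => x; rewrite inE/= => -[_ /eqP x0].
  by rewrite fejer_neq0// cosD; congr EFin; ring.
rewrite E.
have i1 : mu.-integrable setT (EFin \o (fun x => fejer_raw r x * cos (y * x))).
  by apply: integrable_fejer_rawM => // x; exact: cos_max.
have i2 : mu.-integrable setT (EFin \o (fun x => fejer_raw r x * sin (y * x))).
  by apply: integrable_fejer_rawM => // x; exact: sin_max.
rewrite RintegralB//; [|exact: (integrableZl _ _ i1)|exact: (integrableZl _ _ i2)].
rewrite !RintegralZl// Rintegral_fejer_raw_cos// mulr0 sub0r.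
rewrite (Rintegral_odd _ i2) ?mulr0 ?oppr0// => x.
by rewrite /fejer_raw !mulrN cosN sinN sqrrN mulrN.
Qed.

End fejer_kernel.

(** * Iterated integrals on R^n and products of one-dimensional kernels *)

Section lebesgue_rV_theory.
Context {R : realType}.
Local Notation mu := (@lebesgue_measure R).
Local Notation leb := (@lebesgue_rV R _).

Lemma ge0_integral_cons_rV n (f : 'rV[R]_n.+1 -> \bar R) :
  measurable_fun setT f -> (forall p, 0 <= f p)%E ->
  (\int[@lebesgue_rV R n.+1]_p f p =
   \int[mu]_x \int[@lebesgue_rV R n]_v f (cons_rV (x, v)))%E.
Proof.
move=> mf f0.
pose P := (measure_function_pushforward__canonical__measure_function_Measure
    (mu \x @lebesgue_rV R n)%E (@measurable_cons_rV R n)).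
transitivity (\int[P]_p f p)%E; first exact: eq_measure_integral.
rewrite ge0_integral_pushforward//=.
  by rewrite fubini_tonelli1//; apply: measurableT_comp => //; exact: measurable_cons_rV.
exact: measurable_cons_rV.
Qed.

(** Both orders of integration are provided: in [Rintegral_tensor_fejer_cos] the inner integral has
    to be the one that vanishes, and this depends on which coordinate of y is large. *)
Lemma integral_cons_rV n (f : 'rV[R]_n.+1 -> \bar R) :
  (@lebesgue_rV R n.+1).-integrable setT f ->
  (\int[@lebesgue_rV R n.+1]_p f p =
   \int[mu]_x \int[@lebesgue_rV R n]_v f (cons_rV (x, v)))%E /\
  (\int[@lebesgue_rV R n.+1]_p f p =
   \int[@lebesgue_rV R n]_v \int[mu]_x f (cons_rV (x, v)))%E.
Proof.
move=> fi; have mf := measurable_int _ fi.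
have mfc : measurable_fun setT (f \o @cons_rV R n).
  by apply: measurableT_comp => //; exact: measurable_cons_rV.
have fci : (mu \x @lebesgue_rV R n)%E.-integrable setT (f \o @cons_rV R n).
  apply/integrable12ltyP => //; move/integrableP : fi => [_].
  by rewrite ge0_integral_cons_rV//; exact: measurableT_comp.
pose P := (measure_function_pushforward__canonical__measure_function_Measure
    (mu \x @lebesgue_rV R n)%E (@measurable_cons_rV R n)).
have E : (\int[@lebesgue_rV R n.+1]_p f p =
    \int[mu \x @lebesgue_rV R n]_z (f \o @cons_rV R n) z)%E.
  transitivity (\int[P]_p f p)%E; first exact: eq_measure_integral.
  by rewrite integral_pushforward//; exact: measurable_cons_rV.
split; rewrite E.
  by rewrite -integral12_prod_meas1.
by rewrite -integral21_prod_meas1.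
Qed.

Definition tensor n (g : R -> R) (p : 'rV[R]_n) : R := \prod_i g (p ord0 i).

Lemma tensor_cons_rV n g x (v : 'rV[R]_n) :
  tensor n.+1 g (cons_rV (x, v)) = g x * tensor n g v.
Proof.
rewrite /tensor big_ord_recl mxE unlift_none/=; congr (_ * _).
by apply: eq_bigr => i _; rewrite mxE liftK.
Qed.

Lemma measurable_tensor n g : measurable_fun setT g ->
  measurable_fun setT (tensor n g).
Proof.
move=> mg; apply: measurable_prod => i _.
by apply: (measurableT_comp mg); exact: measurable_coord.
Qed.

Lemma tensor_ge0 n g p : (forall x, 0 <= g x) -> 0 <= tensor n g p.
Proof. by move=> g0; apply: prodr_ge0. Qed.

Lemma integrable_tensor n g : (forall x, 0 <= g x) ->
  mu.-integrable setT (EFin \o g) ->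
  (@lebesgue_rV R n).-integrable setT (EFin \o tensor n g).
Proof.
move=> g0 gi; have mg : measurable_fun setT g.
  by apply/measurable_EFinP; exact: measurable_int gi.
elim: n => [|n IHn].
  apply/integrableP; split.
    by apply/measurable_EFinP; exact: measurable_tensor.
  rewrite integral_dirac//.
    by rewrite diracE mem_set// mul1e ltry.
  by apply/measurable_EFinP/measurableT_comp => //; exact: measurable_tensor.
apply/integrableP; split.
  by apply/measurable_EFinP; exact: measurable_tensor.
rewrite ge0_integral_cons_rV//; last first.
  by apply/measurable_EFinP/measurableT_comp => //; exact: measurable_tensor.
under eq_integral => x _.
  under eq_integral => v _.
    rewrite /= tensor_cons_rV ger0_norm ?mulr_ge0 ?g0 ?tensor_ge0// EFinM; over.
  rewrite ge0_integralZl_EFin//; last 2 first.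
  - by move=> v _; rewrite lee_fin tensor_ge0.
  - by apply/measurable_EFinP; exact: measurable_tensor.
  over.
set c := (\int[@lebesgue_rV R n]_v (tensor n g v)%:E)%E.
have c0 : (0 <= c)%E by apply: integral_ge0 => v _; rewrite lee_fin tensor_ge0.
have cfin : c \is a fin_num by exact: (integrable_fin_num _ IHn).
rewrite -(fineK cfin) ge0_integralZr//.
- rewrite fineK// lte_mul_pinfty//.
  + by apply: integral_ge0 => x _; rewrite lee_fin.
  + exact: (integrable_fin_num _ gi).
  + by rewrite ltey_eq cfin.
- by apply/measurable_EFinP.
- by move=> x _; rewrite lee_fin.
- by rewrite fineK.
Qed.
Lemma dotprodC n (p x : 'rV[R]_n) : dotprod p x = dotprod x p.
Proof. by apply: eq_bigr => i _; rewrite mulrC. Qed.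

Lemma dotprodBl n (p q x : 'rV[R]_n) : dotprod (p - q) x = dotprod p x - dotprod q x.
Proof.
by rewrite /dotprod -sumrB; apply: eq_bigr => i _; rewrite !mxE mulrBl.
Qed.

Lemma dotprodNl n (p x : 'rV[R]_n) : dotprod (- p) x = - dotprod p x.
Proof.
by rewrite /dotprod -sumrN; apply: eq_bigr => i _; rewrite !mxE mulNr.
Qed.

Lemma dotprod_cons_rV n (y : 'rV[R]_n.+1) x (v : 'rV[R]_n) :
  dotprod y (cons_rV (x, v)) =
  y ord0 ord0 * x + dotprod (\row_i y ord0 (lift ord0 i)) v.
Proof.
rewrite /dotprod big_ord_recl mxE unlift_none/=; congr (_ + _).
by apply: eq_bigr => i _; rewrite !mxE liftK.
Qed.

Lemma measurable_dotprod d (T : measurableType d) n (f g : T -> 'rV[R]_n) :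
  measurable_fun setT f -> measurable_fun setT g ->
  measurable_fun setT (fun x => dotprod (f x) (g x)).
Proof.
move=> mf mg; apply: measurable_sum => i.
by apply: measurable_funM; apply: (measurableT_comp (measurable_coord i)).
Qed.

Lemma measurable_cos_dotprod n (y : 'rV[R]_n) t :
  measurable_fun setT (fun p => cos (dotprod y p + t)).
Proof.
apply: (measurableT_comp measurable_cos); apply: measurable_funD => //.
exact: measurable_dotprod.
Qed.

Lemma integrable_fejer r : mu.-integrable setT (EFin \o fejer r).
Proof.
apply: le_integrable (integrableZl measurableT (r ^+ 2 + 2) integrable_invD1sqr) => //.
- by apply/measurable_EFinP; exact: measurable_fejer.
- move=> x _; rewrite lee_fin !ger0_norm ?fejer_ge0//; last first.
    by rewrite mulr_ge0 ?(ltW (invD1sqr_gt0 _)) ?addr_ge0 ?sqr_ge0.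
  exact: fejer_le.
Qed.

Lemma integral_EFin {d} {T : measurableType d} {m : {measure set T -> \bar R}}
    {f : T -> R} : m.-integrable setT (EFin \o f) ->
  (\int[m]_x (f x)%:E = (\int[m]_x f x)%:E)%E.
Proof. by move=> fi; rewrite fineK//; exact: integrable_fin_num fi. Qed.

Lemma integrableM_bounded {d} {T : measurableType d} {m : {measure set T -> \bar R}}
    {f g : T -> R} {M} : m.-integrable setT (EFin \o f) ->
  measurable_fun setT g -> (forall x, `|g x| <= M) ->
  m.-integrable setT (EFin \o (fun x => f x * g x)).
Proof.
move=> fi mg gM; apply: le_integrable (integrableZl measurableT M fi) => //.
  apply/measurable_EFinP/measurable_funM => //.
  by apply/measurable_EFinP; exact: measurable_int fi.
move=> x _ /=; rewrite lee_fin !normrM mulrC ler_wpM2r//.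
by rewrite (le_trans (gM x)) ?ler_norm.
Qed.

Lemma integrable_tensor_fejer n r :
  (@lebesgue_rV R n).-integrable setT (EFin \o tensor n (fejer r)).
Proof. exact: (integrable_tensor n _ (fejer_ge0 r) (integrable_fejer r)). Qed.

Lemma measurable_tensor_fejer n r : measurable_fun setT (tensor n (fejer r)).
Proof. by apply: measurable_tensor; exact: measurable_fejer. Qed.

(** The cosine of a sum does not factor over the coordinates, but once some coordinates are frozen
    their contribution is absorbed in the phase. This is why t is arbitrary here and in the
    one-dimensional case. *)
Lemma Rintegral_tensor_fejer_cos n (r : R) (y : 'rV[R]_n) t : 0 <= r ->
  (exists i, r <= `|y ord0 i|) ->
  \int[@lebesgue_rV R n]_p (tensor n (fejer r) p * cos (dotprod y p + t)) = 0.
Proof.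
move=> r0; elim: n => [|n IHn] in y t * => -[i ryi]; first by case: i ryi.
have I k (z : 'rV[R]_k) s : (@lebesgue_rV R k).-integrable setT
    (EFin \o (fun p => tensor k (fejer r) p * cos (dotprod z p + s))).
  apply: integrableM_bounded (integrable_tensor_fejer k r) _ _.
    exact: measurable_cos_dotprod.
  by move=> x; exact: cos_max.
rewrite /Rintegral; have [/= Ei1 Ei2] := integral_cons_rV _ _ (I _ y t).
case: (unliftP ord0 i) => [j ij|i0].
  rewrite Ei1 integral0_eq// => x _.
  under eq_integral.
    move=> v _; rewrite tensor_cons_rV dotprod_cons_rV.
    rewrite [_ + dotprod _ _]addrC -addrA -mulrA EFinM.
  over.
  rewrite integralZl//; last exact: I.
  rewrite (integral_EFin (I _ _ _)) IHn ?mule0//.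
  by exists j; rewrite mxE -ij.
rewrite Ei2 integral0_eq// => v _.
under eq_integral.
  move=> x _; rewrite tensor_cons_rV dotprod_cons_rV -addrA mulrAC mulrC EFinM.
over.
have Ii s : mu.-integrable setT (EFin \o (fun x => fejer r x * cos (y ord0 ord0 * x + s))).
  apply: integrableM_bounded (integrable_fejer r) (measurable_cosD _ _) _ => x.
  exact: cos_max.
rewrite integralZl//; last exact: Ii.
rewrite (integral_EFin (Ii _)) Rintegral_fejer_cosD ?mule0//.
by rewrite r0 -i0.
Qed.

End lebesgue_rV_theory.

(** * Continuity of the pairings in both norms, and Fubini for Fourier integrals *)

Section norms.
Context {R : realType} {n : nat}.
Local Notation Rn := 'rV[R]_n.
Local Notation leb := (@lebesgue_rV R n).
Implicit Types (f phi chi psi u : Rn -> R[i]) (g h : Rn -> R) (m r t : R).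

Lemma ReB (x y : R[i]) : complex.Re (x - y) = complex.Re x - complex.Re y.
Proof. by case: x => a b; case: y => c d. Qed.

Lemma ImB (x y : R[i]) : complex.Im (x - y) = complex.Im x - complex.Im y.
Proof. by case: x => a b; case: y => c d. Qed.

Lemma normc_sqr (z : R[i]) :
  Normc.normc z ^+ 2 = complex.Re z ^+ 2 + complex.Im z ^+ 2.
Proof. by case: z => a b; rewrite sqr_sqrtr// addr_ge0 ?sqr_ge0. Qed.

Lemma normc_ge0 (z : R[i]) : 0 <= Normc.normc z.
Proof. by case: z => a b; rewrite sqrtr_ge0. Qed.

Lemma normr_Re_le (z : R[i]) : `|complex.Re z| <= Normc.normc z.
Proof.
rewrite -ler_sqr ?nnegrE ?normc_ge0// normc_sqr real_normK ?num_real//.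
by rewrite lerDl sqr_ge0.
Qed.

Lemma normr_Im_le (z : R[i]) : `|complex.Im z| <= Normc.normc z.
Proof.
rewrite -ler_sqr ?nnegrE ?normc_ge0// normc_sqr real_normK ?num_real//.
by rewrite lerDr sqr_ge0.
Qed.

Lemma cmeasurableB f chi : cmeasurable f -> cmeasurable chi ->
  cmeasurable (fun p => f p - chi p).
Proof.
move=> [f1 f2] [g1 g2]; split.
  by under eq_fun do rewrite ReB; exact: measurable_funB.
by under eq_fun do rewrite ImB; exact: measurable_funB.
Qed.

Lemma measurable_normc_sqr f : cmeasurable f ->
  measurable_fun setT (fun p => Normc.normc (f p) ^+ 2).
Proof.
move=> [f1 f2]; under eq_fun do rewrite normc_sqr.
by apply: measurable_funD; exact: measurable_funX.
Qed.

Lemma measurable_normc f : cmeasurable f ->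
  measurable_fun setT (fun p => Normc.normc (f p)).
Proof.
move=> /measurable_normc_sqr mf.
rewrite [X in measurable_fun _ X](_ : _ =
    (fun p => Num.sqrt (Normc.normc (f p) ^+ 2))).
  apply: (measurableT_comp _ mf); apply: continuous_measurable_fun.
  exact: sqrt_continuous.
by apply/funext => p; rewrite sqrtr_sqr ger0_norm ?normc_ge0.
Qed.

(** The division by 1 gives the conclusion the shape of [rnorm_le] with weight 1, so that
    [pairing_bound] serves both norms. *)
Lemma cLnorm2_le f (e : R) : 0 <= e -> (cLnorm 2 f <= e%:E)%E ->
  (\int[leb]_p (Normc.normc (f p) ^+ 2 / 1)%:E <= (e ^+ 2)%:E)%E.
Proof.
move=> e0; rewrite /cLnorm => fe.
have -> : (\int[leb]_p (Normc.normc (f p) ^+ 2 / 1)%:E =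
    'N[leb]_2%:E[EFin \o (@Normc.normc R \o f)] `^ 2)%E.
  rewrite powR_Lnorm//; apply: eq_integral => p _ /=.
  by rewrite divr1 ger0_norm ?normc_ge0// powR_mulrn// normc_ge0.
rewrite -powR_mulrn// -poweR_EFin; apply: gt0_ler_poweR => //.
- by rewrite in_itv/= Lnorm_ge0 leey.
- by rewrite in_itv/= lee_fin e0 leey.
Qed.

Lemma rnorm_le m f (e : R) : 0 <= e -> (rnorm m f <= e%:E)%E ->
  (\int[leb]_p (Normc.normc (f p) ^+ 2 / energy m p)%:E <= (e ^+ 2)%:E)%E.
Proof.
move=> e0; rewrite /rnorm => fe.
set X := integral _ _ _ in fe *.
have X0 : (0 <= X)%E.
  by apply: integral_ge0 => p _; rewrite lee_fin divr_ge0 ?sqr_ge0 ?sqrtr_ge0.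
have -> : X = ((X `^ 2^-1) `^ 2)%E by rewrite -poweRrM mulVf// poweRe1.
rewrite -powR_mulrn// -poweR_EFin; apply: gt0_ler_poweR => //.
- by rewrite in_itv/= poweR_ge0 leey.
- by rewrite in_itv/= lee_fin e0 leey.
Qed.

(* AM-GM: [2 |g h| <= g^2 / (e E) + e h^2 E]. *)
Lemma integral_normM_le d (T : measurableType d) (mu : {measure set T -> \bar R})
    (g h E : T -> R) (e K : R) :
  measurable_fun setT g -> measurable_fun setT h -> measurable_fun setT E ->
  (forall p, 0 < E p) -> 0 < e ->
  (\int[mu]_p (g p ^+ 2 / E p)%:E <= (e ^+ 2)%:E)%E ->
  (\int[mu]_p (h p ^+ 2 * E p)%:E <= K%:E)%E ->
  (\int[mu]_p `|(g p * h p)%:E| <= (e * (1 + K) / 2)%:E)%E.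
Proof.
move=> mg mh mE E0 e0 gE hE.
have mgE : measurable_fun setT (fun p => (g p ^+ 2 / E p)%:E).
  apply/measurable_EFinP/measurable_funM; first exact: measurable_funX.
  exact: (measurableT_comp measurable_invr).
have mhE : measurable_fun setT (fun p => (h p ^+ 2 * E p)%:E).
  by apply/measurable_EFinP/measurable_funM => //; exact: measurable_funX.
have gE0 p : (0 <= (g p ^+ 2 / E p)%:E)%E.
  by rewrite lee_fin divr_ge0 ?sqr_ge0 ?ltW.
have hE0 p : (0 <= (h p ^+ 2 * E p)%:E)%E.
  by rewrite lee_fin mulr_ge0 ?sqr_ge0 ?ltW.
apply: (@le_trans _ _ (\int[mu]_p ((2 * e)^-1%:E * (g p ^+ 2 / E p)%:E +
    (e / 2)%:E * (h p ^+ 2 * E p)%:E))%E).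
  apply: ge0_le_integral => //.
  - apply/measurableT_comp => //; apply/measurable_EFinP.
    exact: measurable_funM.
  - by apply: emeasurable_funD; exact: measurable_funeM.
  - move=> p _; rewrite -!EFinM -EFinD abse_EFin lee_fin -subr_ge0.
    set a := `|g p|; set b := `|h p|.
    have -> : g p ^+ 2 = a ^+ 2 by rewrite real_normK ?num_real.
    have -> : h p ^+ 2 = b ^+ 2 by rewrite real_normK ?num_real.
    rewrite normrM -/a -/b.
    have -> : (2 * e)^-1 * (a ^+ 2 / E p) + e / 2 * (b ^+ 2 * E p) - a * b =
        (2 * e * E p)^-1 * (a - e * E p * b) ^+ 2.
      by field; rewrite !gt_eqF.
    by rewrite mulr_ge0 ?sqr_ge0// invr_ge0 !mulr_ge0 ?ltW.
rewrite ge0_integralD//; last 4 first.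
- by move=> p _; rewrite mule_ge0// lee_fin invr_ge0 mulr_ge0// ltW.
- exact: measurable_funeM.
- by move=> p _; rewrite mule_ge0// lee_fin divr_ge0// ltW.
- exact: measurable_funeM.
rewrite !ge0_integralZl_EFin//; last 2 first.
- by rewrite divr_ge0// ltW.
- by rewrite invr_ge0 mulr_ge0// ltW.
have -> : (e * (1 + K) / 2)%:E = ((2 * e)^-1%:E * (e ^+ 2)%:E + (e / 2)%:E * K%:E)%E.
  by rewrite -!EFinM -EFinD; congr EFin; field; rewrite gt_eqF.
by rewrite leeD// lee_wpmul2l// lee_fin ?divr_ge0 ?invr_ge0 ?mulr_ge0// ltW.
Qed.

(* The real part of [e^(i (c.p + t)) phi(p)]. *)
Definition phase_Re phi (c : Rn) (t : R) (p : Rn) : R :=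
  complex.Re (phi p) * cos (dotprod c p + t) -
  complex.Im (phi p) * sin (dotprod c p + t).

(** For real h, this is the real part of e^(it) times the complex pairing of phi h with e^(i c.p): t
    = 0 gives its real part and t = - pi / 2 its imaginary part. *)
Definition pairing phi h (c : Rn) (t : R) : R :=
  \int[leb]_p (phase_Re phi c t p * h p).

Lemma measurable_sin_dotprod (y : Rn) (t : R) :
  measurable_fun setT (fun p => sin (dotprod y p + t)).
Proof.
apply: (measurableT_comp measurable_sin); apply: measurable_funD => //.
exact: measurable_dotprod.
Qed.

Lemma measurable_phase_Re phi c t : cmeasurable phi ->
  measurable_fun setT (phase_Re phi c t).
Proof.
move=> [m1 m2]; apply: measurable_funB; apply: measurable_funM => //.
  exact: measurable_cos_dotprod.
exact: measurable_sin_dotprod.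
Qed.

Lemma phase_Re_sqr_le phi c t p :
  phase_Re phi c t p ^+ 2 <= Normc.normc (phi p) ^+ 2.
Proof.
rewrite normc_sqr /phase_Re; set a := complex.Re _; set b := complex.Im _.
set s := dotprod c p + t.
have -> : a ^+ 2 + b ^+ 2 =
    (a * cos s - b * sin s) ^+ 2 + (a * sin s + b * cos s) ^+ 2.
  rewrite -[LHS]mulr1 -(cos2Dsin2 s); ring.
by rewrite lerDl sqr_ge0.
Qed.

Lemma phase_ReB phi chi c t p : phase_Re (fun p => phi p - chi p) c t p =
  phase_Re phi c t p - phase_Re chi c t p.
Proof. by rewrite /phase_Re ReB ImB; ring. Qed.

(** Continuity of the pairing in the norm with weight 1/E: the bound is linear in e once the dual
    weighted norm of h is finite. *)
Lemma pairing_bound phi h c t (E : Rn -> R) (e K : R) : cmeasurable phi ->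
  measurable_fun setT h -> measurable_fun setT E -> (forall p, 0 < E p) -> 0 < e ->
  (\int[leb]_p (Normc.normc (phi p) ^+ 2 / E p)%:E <= (e ^+ 2)%:E)%E ->
  (\int[leb]_p (h p ^+ 2 * E p)%:E <= K%:E)%E ->
  leb.-integrable setT (EFin \o (fun p => phase_Re phi c t p * h p)) /\
  `|pairing phi h c t| <= e * (1 + K) / 2.
Proof.
move=> mphi mh mE E0 e0 phie hK.
have mp := measurable_phase_Re phi c t mphi.
have ph : measurable_fun setT (EFin \o (fun p => phase_Re phi c t p * h p)).
  exact/measurable_EFinP/measurable_funM.
have le : (\int[leb]_p `|(phase_Re phi c t p * h p)%:E| <= (e * (1 + K) / 2)%:E)%E.
  apply: (integral_normM_le _ _ _ _ _ E) => //; apply: le_trans phie.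
  have mV := measurableT_comp measurable_invr mE.
  apply: ge0_le_integral => //.
  - by move=> p _; rewrite lee_fin divr_ge0 ?sqr_ge0 ?ltW.
  - by apply/measurable_EFinP/measurable_funM => //; exact: measurable_funX.
  - by apply/measurable_EFinP/measurable_funM => //; exact: measurable_normc_sqr.
  - by move=> p _; rewrite lee_fin ler_wpM2r ?phase_Re_sqr_le// invr_ge0 ltW.
have I : leb.-integrable setT (EFin \o (fun p => phase_Re phi c t p * h p)).
  by apply/integrableP; split => //; apply: le_lt_trans le _; exact: ltry.
split => //; rewrite -lee_fin EFin_normr_Rintegral//.
by apply: le_trans le; apply: le_abse_integral.
Qed.

Lemma pairingB phi chi h c t :
  leb.-integrable setT (EFin \o (fun p => phase_Re phi c t p * h p)) ->
  leb.-integrable setT (EFin \o (fun p => phase_Re chi c t p * h p)) ->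
  pairing (fun p => phi p - chi p) h c t = pairing phi h c t - pairing chi h c t.
Proof.
move=> i1 i2; rewrite /pairing -RintegralB//.
by apply: eq_Rintegral => p _; rewrite phase_ReB mulrBl.
Qed.

Lemma sum_le_prodD1 (I : Type) (s : seq I) (a : I -> R) : (forall i, 0 <= a i) ->
  1 + \sum_(i <- s) a i <= \prod_(i <- s) (1 + a i).
Proof.
move=> a0; elim: s => [|i s IHs]; first by rewrite !big_nil addr0.
rewrite !big_cons mulrDl mul1r.
have h : 1 <= \prod_(j <- s) (1 + a j).
  by apply: le_trans IHs; rewrite lerDl sumr_ge0.
have := a0 i; nra.
Qed.

Lemma sum_sqr_le (I : Type) (s : seq I) (a : I -> R) : (forall i, 0 <= a i) ->
  \sum_(i <- s) a i ^+ 2 <= (\sum_(i <- s) a i) ^+ 2.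
Proof.
move=> a0; elim: s => [|i s IHs]; first by rewrite !big_nil expr0n.
rewrite !big_cons sqrrD -addrA lerD2l (le_trans IHs)// lerDr.
by rewrite mulrn_wge0// mulr_ge0// sumr_ge0.
Qed.

(** The product form lets the growth of the energy be shared out among the one-dimensional factors
    of the kernel. *)
Lemma energy_le m (p : Rn) : 0 < m ->
  energy m p <= (m + 1) * \prod_i (1 + `|p ord0 i|).
Proof.
move=> m0; set S := \sum_i `|p ord0 i|.
have S0 : 0 <= S by rewrite sumr_ge0.
apply: (@le_trans _ _ (m + S)).
  have mS : 0 <= m + S by rewrite addr_ge0// ltW.
  rewrite -[leRHS](ger0_norm mS) -sqrtr_sqr ler_wsqrtr//.
  have -> : dotprod p p = \sum_i `|p ord0 i| ^+ 2.
    by apply: eq_bigr => i _; rewrite -expr2 real_normK ?num_real.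
  apply: (@le_trans _ _ (S ^+ 2 + m ^+ 2)); first by rewrite lerD2r sum_sqr_le.
  by rewrite sqrrD; nra.
have : 1 + S <= \prod_i (1 + `|p ord0 i|) by exact: sum_le_prodD1.
nra.
Qed.

Lemma energy_gt0 m (p : Rn) : 0 < m -> 0 < energy m p.
Proof.
move=> m0; rewrite sqrtr_gt0 ltr_wpDl ?exprn_gt0//.
by apply: sumr_ge0 => i _; rewrite -expr2 sqr_ge0.
Qed.

Lemma measurable_energy m : measurable_fun setT (@energy R n m).
Proof.
apply: (@measurableT_comp _ _ _ _ _ _ (@Num.sqrt R)).
  by apply: continuous_measurable_fun; exact: sqrt_continuous.
by apply: measurable_funD => //; exact: measurable_dotprod.
Qed.

(** Squaring the majorant gives two factors 1 / (1 + x^2): one absorbs the growth 1 + |x|, at the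
    cost of the constant 2, and the other remains for integrability. *)
Lemma fejer_sqr_le r x :
  fejer r x ^+ 2 * (1 + `|x|) <= (2 * (r ^+ 2 + 2) ^+ 2) * invD1sqr x.
Proof.
set C := r ^+ 2 + 2; set q := invD1sqr x.
have q0 : 0 < q by exact: invD1sqr_gt0.
have fC : fejer r x <= C * q by exact: fejer_le.
have qx : q * (1 + `|x|) <= 2.
  rewrite mulrC ler_pdivrMr ?ltr_pwDl ?sqr_ge0// -(real_normK (num_real x)).
  have := normr_ge0 x; nra.
apply: (@le_trans _ _ ((C * q) ^+ 2 * (1 + `|x|))).
  by rewrite ler_wpM2r ?addr_ge0// lerXn2r ?nnegrE ?fejer_ge0 ?(le_trans _ fC) ?fejer_ge0.
have -> : (C * q) ^+ 2 * (1 + `|x|) = C ^+ 2 * q * (q * (1 + `|x|)) by ring.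
have -> : 2 * C ^+ 2 * q = C ^+ 2 * q * 2 by ring.
by rewrite ler_wpM2l// mulr_ge0 ?sqr_ge0// ltW.
Qed.

(** Applied with E the energy for the norm of L^2_r, and with E = 1 for the L^2 norm in which
    Fourier transforms are approximated. *)
Lemma integral_tensor_fejer_sqr_lty r (M : R) (E : Rn -> R) : 0 <= M ->
  measurable_fun setT E -> (forall p, 0 < E p) ->
  (forall p, E p <= M * \prod_i (1 + `|p ord0 i|)) ->
  exists K, (\int[leb]_p (tensor n (fejer r) p ^+ 2 * E p)%:E <= K%:E)%E.
Proof.
move=> M0 mE E0 EM; set D := 2 * (r ^+ 2 + 2) ^+ 2.
have D0 : 0 <= D by rewrite mulr_ge0// sqr_ge0.
have I : leb.-integrable setT (EFin \o tensor n (fun x => D * invD1sqr x)).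
  apply: integrable_tensor => [x|].
    by rewrite mulr_ge0// ltW ?invD1sqr_gt0.
  exact: (integrableZl measurableT D integrable_invD1sqr).
exists (\int[leb]_p (M * tensor n (fun x => D * invD1sqr x) p)).
have I' : leb.-integrable setT
    (EFin \o (fun p => M * tensor n (fun x => D * invD1sqr x) p)).
  exact: (integrableZl measurableT M I).
rewrite -(integral_EFin I'); apply: ge0_le_integral => //.
- by move=> p _; rewrite lee_fin mulr_ge0 ?sqr_ge0 ?ltW.
- apply/measurable_EFinP/measurable_funM => //; apply: measurable_funX.
  exact: measurable_tensor_fejer.
- exact: (measurable_int _ I').
move=> p _; rewrite lee_fin.
apply: (@le_trans _ _ (tensor n (fejer r) p ^+ 2 * (M * \prod_i (1 + `|p ord0 i|)))).
  by rewrite ler_wpM2l ?sqr_ge0.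
rewrite mulrCA ler_wpM2l// -prodrXl -big_split/=; apply: ler_prod => i _.
by rewrite fejer_sqr_le mulr_ge0 ?sqr_ge0 ?addr_ge0.
Qed.

Lemma integrable_prod_bounded {d1 d2} {T1 : measurableType d1} {T2 : measurableType d2}
    {m1 : {sigma_finite_measure set T1 -> \bar R}}
    {m2 : {sigma_finite_measure set T2 -> \bar R}}
    {a : T1 -> R} {b : T2 -> R} {k : T1 * T2 -> R} :
  m1.-integrable setT (EFin \o a) -> m2.-integrable setT (EFin \o b) ->
  measurable_fun setT k -> (forall z, `|k z| <= 1) ->
  (m1 \x m2)%E.-integrable setT (EFin \o (fun z => a z.1 * b z.2 * k z)).
Proof.
move=> ia ib mk k1.
have ma : measurable_fun setT a by apply/measurable_EFinP; exact: measurable_int ia.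
have mb : measurable_fun setT b by apply/measurable_EFinP; exact: measurable_int ib.
have mab : measurable_fun setT (fun z : T1 * T2 => a z.1 * b z.2).
  by apply: measurable_funM; [exact: (measurableT_comp ma measurable_fst)|
                              exact: (measurableT_comp mb measurable_snd)].
have iab : (m1 \x m2)%E.-integrable setT (EFin \o (fun z => a z.1 * b z.2)).
  apply/integrable12ltyP; first exact/measurable_EFinP.
  under eq_integral => x _.
    under eq_integral => y _ do rewrite /= normrM EFinM.
    rewrite ge0_integralZl_EFin//; last first.
      by apply/measurable_EFinP; exact: measurableT_comp.
    over.
  have /integrableP[_ la] := ia; have /integrableP[_ lb] := ib.
  have lb0 : (0 <= \int[m2]_y (`|b y|)%:E)%E by apply: integral_ge0 => y _; rewrite lee_fin.
  have lbf : (\int[m2]_y (`|b y|)%:E)%E \is a fin_num by rewrite ge0_fin_numE.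
  rewrite -(fineK lbf) ge0_integralZr//.
  - rewrite fineK// lte_mul_pinfty//; first exact: integral_ge0.
    by rewrite ge0_fin_numE//; exact: integral_ge0.
  - by apply/measurable_EFinP; exact: measurableT_comp.
  - by rewrite fineK.
exact: (integrableM_bounded iab mk k1).
Qed.

Lemma integrable_cLp1 u : cLp 1 u ->
  leb.-integrable setT (EFin \o (fun x => complex.Re (u x))) /\
  leb.-integrable setT (EFin \o (fun x => complex.Im (u x))).
Proof.
move=> [mu_]; rewrite /cLnorm Lnorm1 => ul.
have I : leb.-integrable setT (EFin \o (fun x => Normc.normc (u x))).
  by apply/integrableP; split => //; apply/measurable_EFinP; exact: measurable_normc.
have [m1 m2] := mu_.
split; (apply: le_integrable I => //; first exact/measurable_EFinP) => x _;
  rewrite lee_fin (ger0_norm (normc_ge0 _)).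
  exact: normr_Re_le.
exact: normr_Im_le.
Qed.

Definition fourier_cst : R := (2 * pi) `^ (- (n%:R / 2)).

Definition fourier_Re u (p : Rn) : R :=
  \int[leb]_x (complex.Re (u x) * cos (dotprod p x) + complex.Im (u x) * sin (dotprod p x)).

Definition fourier_Im u (p : Rn) : R :=
  \int[leb]_x (complex.Im (u x) * cos (dotprod p x) - complex.Re (u x) * sin (dotprod p x)).

Lemma fourier_integralE u p : fourier_integral u p =
  (fourier_cst * fourier_Re u p +i* (fourier_cst * fourier_Im u p))%C.
Proof.
rewrite /fourier_integral /cintegral -/fourier_cst.
have -> : \int[leb]_x complex.Re (cis (- dotprod p x) * u x) = fourier_Re u p.
  apply: eq_Rintegral => x _; case: (u x) => a b.
  by rewrite /cis cosN sinN /=; ring.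
have -> : \int[leb]_x complex.Im (cis (- dotprod p x) * u x) = fourier_Im u p.
  apply: eq_Rintegral => x _; case: (u x) => a b.
  by rewrite /cis cosN sinN /=; ring.
by rewrite /GRing.mul/= !mul0r subr0 addr0.
Qed.

Section partial_integrals.
Context {d} {T : measurableType d} {mu : {sigma_finite_measure set T -> \bar R}}.
Variables (a : T -> R) (k : T * Rn -> R).
Hypotheses (ia : mu.-integrable setT (EFin \o a)) (mk : measurable_fun setT k)
  (k1 : forall z, `|k z| <= 1).

Lemma integrable_slice p : mu.-integrable setT (EFin \o (fun x => a x * k (x, p))).
Proof.
apply: (integrableM_bounded ia _ (fun x => k1 (x, p))).
exact: (measurableT_comp mk (pair2_measurable p)).
Qed.

(** Fubini yields this measurability for integrable functions on the product, but [a x * k (x, p)]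
    need not be integrable in p. A positive integrable weight [q] is inserted and divided out
    afterwards. *)
Lemma measurable_Rintegral_slice :
  measurable_fun setT (fun p => \int[mu]_x (a x * k (x, p))).
Proof.
pose q := tensor n (@invD1sqr R).
have q0 p : 0 < q p by apply: prodr_gt0 => i _; exact: invD1sqr_gt0.
have iq : leb.-integrable setT (EFin \o q).
  apply: integrable_tensor; last exact: integrable_invD1sqr.
  by move=> x; rewrite ltW ?invD1sqr_gt0.
have mq : measurable_fun setT q by apply: measurable_tensor; exact: measurable_invD1sqr.
have I := integrable_prod_bounded ia iq mk k1.
rewrite [X in measurable_fun _ X](_ : _ =
    (fun p => (q p)^-1 * fine (fubini_G mu (EFin \o (fun z => a z.1 * q z.2 * k z)) p))).
  apply: measurable_funM; first exact: (measurableT_comp measurable_invr mq).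
  by apply: measurableT_comp => //; exact: (measurable_fubini_G I).
apply/funext => p; rewrite /fubini_G -/(Rintegral _ _ _).
under [in RHS]eq_Rintegral do rewrite /= mulrAC mulrC.
rewrite RintegralZl//; last exact: integrable_slice.
by rewrite mulrA mulVf ?mul1r// gt_eqF.
Qed.

Lemma Rintegral_slice_swap (b : Rn -> R) : leb.-integrable setT (EFin \o b) ->
  [/\ mu.-integrable setT (EFin \o (fun x => \int[leb]_p (a x * b p * k (x, p)))),
      leb.-integrable setT (EFin \o (fun p => \int[mu]_x (a x * b p * k (x, p)))) &
      \int[leb]_p \int[mu]_x (a x * b p * k (x, p)) =
      \int[mu]_x \int[leb]_p (a x * b p * k (x, p))].
Proof.
move=> ib; have I := integrable_prod_bounded ia ib mk k1.
have E1 x : (\int[leb]_p (a x * b p * k (x, p))%:E =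
    (\int[leb]_p (a x * b p * k (x, p)))%:E)%E.
  apply: integral_EFin; apply: (integrableM_bounded _ _ (fun p => k1 (x, p))).
    exact: (integrableZl measurableT (a x) ib).
  exact: (measurableT_comp mk (pair1_measurable x)).
have E2 p : (\int[mu]_x (a x * b p * k (x, p))%:E =
    (\int[mu]_x (a x * b p * k (x, p)))%:E)%E.
  apply: integral_EFin; apply: (integrableM_bounded _ _ (fun x => k1 (x, p))).
    exact: (eq_integrable _ _ _ _ (integrableZr measurableT (b p) ia)).
  exact: (measurableT_comp mk (pair2_measurable p)).
split.
- apply: eq_integrable (integrable_fubini_F I) => // x _ /=.
  by rewrite /fubini_F E1.
- have mk' : measurable_fun setT (fun z : Rn * T => k (z.2, z.1)).
    apply: (measurableT_comp mk (g := fun z : Rn * T => (z.2, z.1))).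
    exact: measurable_fun_pair.
  have I' := integrable_prod_bounded ib ia mk' (fun z => k1 (z.2, z.1)).
  apply: eq_integrable (integrable_fubini_F I') => // p _ /=.
  by rewrite -E2; apply: eq_integral => x _; rewrite /= [b p * _]mulrC.
rewrite /Rintegral; congr fine.
under eq_integral do rewrite -/(Rintegral _ _ _) -E2.
under [RHS]eq_integral do rewrite -/(Rintegral _ _ _) -E1.
exact/esym/(Fubini I).
Qed.

End partial_integrals.

Lemma measurable_dotprod_swap :
  measurable_fun setT (fun z : Rn * Rn => dotprod z.2 z.1).
Proof. exact: measurable_dotprod. Qed.

Lemma measurable_cos_pair : measurable_fun setT (fun z : Rn * Rn => cos (dotprod z.2 z.1)).
Proof. exact: (measurableT_comp measurable_cos measurable_dotprod_swap). Qed.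

Lemma measurable_sin_pair : measurable_fun setT (fun z : Rn * Rn => sin (dotprod z.2 z.1)).
Proof. exact: (measurableT_comp measurable_sin measurable_dotprod_swap). Qed.

Lemma cmeasurable_fourier_integral u : cLp 1 u -> cmeasurable (fourier_integral u).
Proof.
move=> /integrable_cLp1[i1 i2].
have kc (z : Rn * Rn) : `|cos (dotprod z.2 z.1) : R| <= 1 := cos_max _.
have ks (z : Rn * Rn) : `|sin (dotprod z.2 z.1) : R| <= 1 := sin_max _.
split; under eq_fun do rewrite fourier_integralE /=; apply: measurable_funM => //.
- rewrite /fourier_Re; under eq_fun => p.
    rewrite RintegralD//; last 2 first.
    + exact: (integrable_slice _ _ i1 measurable_cos_pair kc).
    + exact: (integrable_slice _ _ i2 measurable_sin_pair ks).
    over.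
  apply: measurable_funD.
    exact: (measurable_Rintegral_slice _ _ i1 measurable_cos_pair kc).
  exact: (measurable_Rintegral_slice _ _ i2 measurable_sin_pair ks).
- rewrite /fourier_Im; under eq_fun => p.
    rewrite RintegralB//; last 2 first.
    + exact: (integrable_slice _ _ i2 measurable_cos_pair kc).
    + exact: (integrable_slice _ _ i1 measurable_sin_pair ks).
    over.
  apply: measurable_funB.
    exact: (measurable_Rintegral_slice _ _ i2 measurable_cos_pair kc).
  exact: (measurable_Rintegral_slice _ _ i1 measurable_sin_pair ks).
Qed.

(** The phases combine: e^(i(c.p + t)) e^(-i p.x) = e^(i((c - x).p + t)). This is the origin of the
    argument c - x of the kernel's transform below. *)
Lemma phase_Re_fourier u c t p : cLp 1 u ->
  phase_Re (fourier_integral u) c t p = fourier_cst *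
   (\int[leb]_x (complex.Re (u x) * cos (dotprod (c - x) p + t)) -
    \int[leb]_x (complex.Im (u x) * sin (dotprod (c - x) p + t))).
Proof.
move=> /integrable_cLp1[i1 i2].
have mk (k : R -> R) s : measurable_fun setT k ->
    measurable_fun setT (fun x : Rn => k (dotprod s x)).
  by move=> mk; apply: (measurableT_comp mk); exact: measurable_dotprod.
pose A := \int[leb]_x (complex.Re (u x) * cos (dotprod p x)).
pose B := \int[leb]_x (complex.Re (u x) * sin (dotprod p x)).
pose C := \int[leb]_x (complex.Im (u x) * cos (dotprod p x)).
pose D := \int[leb]_x (complex.Im (u x) * sin (dotprod p x)).
have ic a : leb.-integrable setT (EFin \o a) ->
    leb.-integrable setT (EFin \o (fun x => a x * cos (dotprod p x))).
  move=> ia; apply: (integrableM_bounded ia (mk _ _ measurable_cos)) => x.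
  exact: cos_max.
have is_ a : leb.-integrable setT (EFin \o a) ->
    leb.-integrable setT (EFin \o (fun x => a x * sin (dotprod p x))).
  move=> ia; apply: (integrableM_bounded ia (mk _ _ measurable_sin)) => x.
  exact: sin_max.
have FR : fourier_Re u p = A + D by rewrite /fourier_Re RintegralD//; auto.
have FI : fourier_Im u p = C - B by rewrite /fourier_Im RintegralB//; auto.
pose s := dotprod c p + t.
have sx x : dotprod (c - x) p + t = s - dotprod p x.
  by rewrite dotprodBl (dotprodC _ x p) /s; ring.
have -> : \int[leb]_x (complex.Re (u x) * cos (dotprod (c - x) p + t)) =
    cos s * A + sin s * B.
  rewrite -!RintegralZl//; [|exact: is_|exact: ic].
  rewrite -RintegralD//; [|exact: (integrableZl measurableT _ (ic _ i1))|
                           exact: (integrableZl measurableT _ (is_ _ i1))].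
  by apply: eq_Rintegral => x _; rewrite sx cosB; ring.
have -> : \int[leb]_x (complex.Im (u x) * sin (dotprod (c - x) p + t)) =
    sin s * C - cos s * D.
  rewrite -!RintegralZl//; [|exact: is_|exact: ic].
  rewrite -RintegralB//; [|exact: (integrableZl measurableT _ (ic _ i2))|
                           exact: (integrableZl measurableT _ (is_ _ i2))].
  by apply: eq_Rintegral => x _; rewrite sx sinB; ring.
rewrite /phase_Re fourier_integralE /= FR FI -/s; ring.
Qed.

End norms.

(** * Vanishing of the pairings on H_S when the cube misses S *)

Section duality.
Context {R : realType} {n : nat}.
Local Notation Rn := 'rV[R]_n.
Local Notation leb := (@lebesgue_rV R n).
Implicit Types (phi chi psi u : Rn -> R[i]) (m r t e : R) (c x y p : Rn) (S : set Rn).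
Local Notation fejerV r := (tensor n (fejer r)).

(** Real part of e^(it) times the unnormalized Fourier transform of the product kernel. *)
Definition fejerV_hat r t y : R :=
  \int[leb]_p (fejerV r p * cos (dotprod y p + t)).

Lemma fejerV_hat_bound r t y : `|fejerV_hat r t y| <= \int[leb]_p fejerV r p.
Proof.
have I := integrable_tensor_fejer n r.
have mc := measurable_cos_dotprod _ y t.
have Ic := integrableM_bounded I mc (fun p => cos_max _).
apply: le_trans (le_normr_Rintegral measurableT Ic) _.
apply: le_Rintegral => // [|p _].
  exact: (integrable_norm Ic).
rewrite normrM ger0_norm ?tensor_ge0// ?ler_piMr ?cos_max// ?tensor_ge0//;
  by move=> *; exact: fejer_ge0.
Qed.

(** The multiplication formula: Fubini moves the transform from u to the kernel. The sine that
    accompanies Im u is a cosine with phase t - pi / 2, so [fejerV_hat] covers both parts. *)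
Lemma pairing_fourier u c t r : cLp 1 u ->
  [/\ leb.-integrable setT
        (EFin \o (fun x => complex.Re (u x) * fejerV_hat r t (c - x))),
      leb.-integrable setT
        (EFin \o (fun x => complex.Im (u x) * fejerV_hat r (t - pi / 2) (c - x))) &
      pairing (fourier_integral u) (fejerV r) c t = fourier_cst (R := R) (n := n) *
       (\int[leb]_x (complex.Re (u x) * fejerV_hat r t (c - x)) -
        \int[leb]_x (complex.Im (u x) * fejerV_hat r (t - pi / 2) (c - x)))].
Proof.
move=> u1; have [i1 i2] := integrable_cLp1 _ u1.
pose k s (z : Rn * Rn) := cos (dotprod (c - z.1) z.2 + s).
have mk s : measurable_fun setT (k s).
  apply: (measurableT_comp measurable_cos); apply: measurable_funD => //.
  apply: measurable_dotprod => //; apply: measurable_fun_rV => i.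
  under eq_fun do rewrite !mxE; apply: measurable_funB => //.
  exact: (measurableT_comp (measurable_coord i) measurable_fst).
have k1 s z : `|k s z| <= 1 by exact: cos_max.
have Iw := integrable_tensor_fejer n r.
have V s (a : R) x : \int[leb]_p (a * fejerV r p * k s (x, p)) =
    a * fejerV_hat r s (c - x).
  rewrite -RintegralZl//.
    by apply: eq_Rintegral => p _; rewrite mulrA.
  apply: (integrableM_bounded Iw (measurable_cos_dotprod _ (c - x) s)) => p.
  exact: cos_max.
have Q s (a : Rn -> R) p : leb.-integrable setT (EFin \o a) ->
    \int[leb]_x (a x * fejerV r p * k s (x, p)) =
    fejerV r p * \int[leb]_x (a x * k s (x, p)).
  move=> ia; rewrite -RintegralZl//; last exact: integrable_slice.
  by apply: eq_Rintegral => x _; rewrite mulrAC mulrC.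
have [a1 a2 a3] := Rintegral_slice_swap _ _ i1 (mk t) (k1 t) _ Iw.
have [b1 b2 b3] := Rintegral_slice_swap _ _ i2 (mk (t - pi / 2)) (k1 _) _ Iw.
have VR x : \int[leb]_p (complex.Re (u x) * fejerV r p * k t (x, p)) =
    complex.Re (u x) * fejerV_hat r t (c - x) := V _ _ _.
have VI x : \int[leb]_p (complex.Im (u x) * fejerV r p * k (t - pi / 2) (x, p)) =
    complex.Im (u x) * fejerV_hat r (t - pi / 2) (c - x) := V _ _ _.
rewrite (funext VR) in a1 a3; rewrite (funext VI) in b1 b3.
rewrite (funext (fun p => Q t _ p i1)) in a2 a3.
rewrite (funext (fun p => Q (t - pi / 2) _ p i2)) in b2 b3.
split; [exact: a1|exact: b1|].
rewrite -a3 -b3 -(RintegralB measurableT a2 b2).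
rewrite -(RintegralZl _ measurableT (integrableB measurableT a2 b2)).
apply: eq_Rintegral => p _; rewrite (phase_Re_fourier _ _ _ _ u1) /k/=.
under [X in _ * (_ - X) * _]eq_Rintegral do rewrite -cosBpihalf -addrA.
rewrite -mulrA; congr (_ * _); ring.
Qed.

Lemma fejerV_hat_eq0 r t y : 0 <= r -> (exists i, r <= `|y ord0 i|) ->
  fejerV_hat r t y = 0.
Proof. exact: Rintegral_tensor_fejer_cos. Qed.

(** Half-open so that [lebesgue_rV_box] gives its measure. *)
Definition cube c r : set Rn :=
  [set v | forall i, v ord0 i \in `]((c : Rn) - const_mx r) ord0 i, (c + const_mx r) ord0 i]].

Lemma measurable_cube c r : measurable (cube c r).
Proof.
rewrite (_ : cube c r = \bigcap_(i in [set: 'I_n])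
    (setT `&` (fun v : Rn => v ord0 i) @^-1`
      `]((c : Rn) - const_mx r) ord0 i, (c + const_mx r) ord0 i])).
  apply: fin_bigcap_measurable => [|i _]; first exact: finite_finset.
  exact: measurable_coord.
apply/seteqP; split => [v Bv i _|v Bv i]; first by split=> //; exact: Bv.
by have [] := Bv i I.
Qed.

Lemma lebesgue_cube c r : 0 <= r -> leb (cube c r) = ((r *+ 2) ^+ n)%:E.
Proof.
move=> r0; rewrite lebesgue_rV_box => [|i]; last first.
  by rewrite !mxE lerD2l (le_trans _ r0)// oppr_le0.
rewrite (eq_bigr (fun=> r *+ 2)) => [|i _]; last by rewrite !mxE mulr2n; ring.
by rewrite prodr_const card_ord.
Qed.

Lemma notin_cube c r x : ~ cube c r x -> exists i, r <= `|(c - x) ord0 i|.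
Proof.
move=> nc; have [i /negP] := (existsNP _).2 nc; rewrite in_itv/= !mxE negb_and -leNgt -ltNge => h.
exists i; rewrite !mxE ler_normr; case/orP: h => h; apply/orP; [left|right]; lra.
Qed.

(** Used with a = Re u or Im u. The approximant u need not vanish off S, so the integral is only
    small. The kernel's transform vanishes on S and off the cube; elsewhere psi is 0 almost
    everywhere, so |a| <= |u - psi|. The integrand is thus dominated by |u - psi| times a multiple
    of the indicator of the cube, whose L^2 norm is finite. *)
Lemma integral_fejerV_hat_le (a : Rn -> R) u psi S c t r e : 0 <= r -> 0 < e ->
  measurable_fun setT a -> (forall x, `|a x| <= Normc.normc (u x)) ->
  cmeasurable u -> cLp_on 2 S psi ->
  (forall x, S x -> exists i, r <= `|(c - x) ord0 i|) ->
  (cLnorm 2 (fun x => (u x - psi x)%R) <= e%:E)%E ->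
  leb.-integrable setT (EFin \o (fun x => a x * fejerV_hat r t (c - x))) ->
  `|\int[leb]_x (a x * fejerV_hat r t (c - x))| <=
  e * (1 + (\int[leb]_p fejerV r p) ^+ 2 * (r *+ 2) ^+ n) / 2.
Proof.
move=> r0 e0 ma au mu [[mpsi _] psi0] hS upsi I.
set M := \int[leb]_p fejerV r p.
have M0 : 0 <= M by apply: Rintegral_ge0 => p _; apply: tensor_ge0; exact: fejer_ge0.
pose h x := M * \1_(cube c r) x.
have mh : measurable_fun setT h.
  by apply: measurable_funM => //; apply: measurable_indic; exact: measurable_cube.
have md := cmeasurableB _ _ mu mpsi.
have hK : (\int[leb]_x (h x ^+ 2 * 1)%:E <= (M ^+ 2 * (r *+ 2) ^+ n)%:E)%E.
  have mc := measurable_cube c r.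
  under eq_integral => x _.
    rewrite (_ : h x ^+ 2 * 1 = M ^+ 2 * \1_(cube c r) x) ?EFinM; last first.
      rewrite /h mulr1 exprMn; congr (_ * _).
      by rewrite indicE; case: (_ \in _); rewrite ?expr0n ?expr1n.
    over.
  rewrite ge0_integralZl_EFin ?sqr_ge0//; last first.
    by apply/measurable_EFinP; exact: measurable_indic.
  have -> : (\int[leb]_x (\1_(cube c r) x)%:E = ((r *+ 2) ^+ n)%:E)%E.
    by rewrite integral_indic// setIT; exact: lebesgue_cube.
  by rewrite expr2 -EFinM.
have mone : measurable_fun setT (cst 1 : Rn -> R) by exact: measurable_cst.
have := @integral_normM_le R _ _ leb _ h (cst 1) e _
  (measurable_normc _ md) mh mone (fun=> ltr01) e0
  (cLnorm2_le _ _ (ltW e0) upsi) hK.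
move=> B; rewrite -lee_fin; apply: le_trans B.
rewrite EFin_normr_Rintegral//.
apply: le_trans (le_abse_integral leb measurableT (measurable_int _ I)) _.
apply: ae_ge0_le_integral => //.
- by apply: measurableT_comp => //; exact: measurable_int I.
- apply: measurableT_comp => //; apply/measurable_EFinP/measurable_funM => //.
  exact: measurable_normc.
apply: filterS psi0 => x psi0 _.
rewrite /= lee_fin !normrM (ger0_norm (normc_ge0 _)).
have [xS|xS] := pselect (S x).
  by rewrite fejerV_hat_eq0 ?normr0 ?mulr0 ?mulr_ge0 ?normc_ge0//; exact: hS.
rewrite (psi0 xS) subr0.
have [xc|xc] := pselect (cube c r x); last first.
  rewrite fejerV_hat_eq0 ?normr0 ?mulr0 ?mulr_ge0 ?normc_ge0//.
  exact: notin_cube.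
by rewrite indicE mem_set// normr1 mulr1 ler_pM// (ger0_norm M0) fejerV_hat_bound.
Qed.

Lemma cvge0_le (v : nat -> \bar R) e : 0 < e -> v k @[k --> \oo] --> 0%E ->
  \forall k \near \oo, (v k <= e%:E)%E.
Proof.
move=> e0 /(_ _ (@nbhs_open_ereal_lt R 0 (fun=> e) e0)).
by move=> ve; near=> k; apply/ltW; near: k.
Unshelve. all: by end_near. Qed.

Lemma pairing_is_fourier0 psi chi S c t r : 0 <= r ->
  cLp_on 2 S psi -> is_fourier psi chi ->
  (forall x, S x -> exists i, r <= `|(c - x) ord0 i|) ->
  pairing chi (fejerV r) c t = 0.
Proof.
move=> r0 psiS [_ [mchi chi2] [u [u12 upsi uchi]]] hS.
have mw : measurable_fun setT (fejerV r : Rn -> R) by exact: measurable_tensor_fejer.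
have mone : measurable_fun setT (cst 1 : Rn -> R) by exact: measurable_cst.
have prod1 p : (cst 1 : Rn -> R) p <= 1 * \prod_i (1 + `|p ord0 i|).
  rewrite mul1r (le_trans _ (sum_le_prodD1 _ _ _ _))//= lerDl.
  by apply: sumr_ge0.
have [K hK] := integral_tensor_fejer_sqr_lty r 1 (cst 1) ler01
  mone (fun=> ltr01) prod1.
have Ichi : leb.-integrable setT (EFin \o (fun p => phase_Re chi c t p * fejerV r p)).
  have cfin : cLnorm 2 chi \is a fin_num by rewrite ge0_fin_numE// Lnorm_ge0.
  (* The added 1 makes [e] positive even when the norm is 0. *)
  pose e := fine (cLnorm 2 chi) + 1.
  have e0 : 0 < e by rewrite ltr_wpDl// fine_ge0// Lnorm_ge0.
  have le : (cLnorm 2 chi <= e%:E)%E by rewrite EFinD fineK// leeDl.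
  by have [] := pairing_bound _ _ c t (cst 1) _ _ mchi mw
    mone (fun=> ltr01) e0 (cLnorm2_le _ _ (ltW e0) le) hK.
set M := (\int[leb]_p fejerV r p) ^+ 2 * (r *+ 2) ^+ n.
have M0 : 0 <= M by rewrite mulr_ge0 ?sqr_ge0// exprn_ge0// mulrn_wge0.
pose F := fourier_cst (R := R) (n := n).
have F0 : 0 <= F by exact: powR_ge0.
have K0 : 0 <= K.
  rewrite -lee_fin (le_trans _ hK)//; apply: integral_ge0 => p _.
  by rewrite lee_fin mulr1 sqr_ge0.
(* The first term accounts for replacing chi by the transform of an approximant [u k], the second
   for the part of [u k] off S, with (1 + M) / 2 from each of its real and imaginary parts. *)
pose C := (1 + K) / 2 + F * (1 + M).
have C0 : 0 < C.
  by rewrite ltr_pwDl// ?divr_gt0 ?ltr_pwDl// mulr_ge0// addr_ge0.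
suff H e : 0 < e -> `|pairing chi (fejerV r) c t| <= e * C.
  apply/eqP; rewrite -normr_eq0; apply/negPn/negP => N0.
  have P0 : 0 < `|pairing chi (fejerV r) c t| by rewrite lt_neqAle eq_sym N0/=.
  have := H (`|pairing chi (fejerV r) c t| / (2 * C)).
  rewrite divr_gt0 ?mulr_gt0// => /(_ isT).
  by rewrite invfM mulrA mulfVK ?gt_eqF//; lra.
move=> e0.
have [k _ /(_ k (leqnn k))[/= uk1 uk2]] :=
  filterI (cvge0_le _ _ e0 upsi) (cvge0_le _ _ e0 uchi).
have [u1 _] := u12 k.
have [I1 I2 PE] := pairing_fourier _ c t r u1.
have mu := u1.1.
have mf := cmeasurable_fourier_integral _ u1.
have [ID BD] := pairing_bound _ _ c t (cst 1) _ _ (cmeasurableB _ _ mf mchi) mw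
    mone (fun=> ltr01) e0 (cLnorm2_le _ _ (ltW e0) uk2) hK.
have -> : pairing chi (fejerV r) c t = pairing (fourier_integral (u k)) (fejerV r) c t -
    pairing (fun p => fourier_integral (u k) p - chi p) (fejerV r) c t.
  rewrite [X in X - _](_ : _ = \int[leb]_p
    (phase_Re (fun p => fourier_integral (u k) p - chi p) c t p * fejerV r p +
     phase_Re chi c t p * fejerV r p)).
    by rewrite RintegralD// /pairing addrC addKr.
  by apply: eq_Rintegral => p _; rewrite phase_ReB -mulrDl subrK.
apply: le_trans (ler_normB _ _) _.
have [mu1 mu2] := mu.
have B1 := integral_fejerV_hat_le _ _ _ _ c t r e r0 e0 mu1
  (fun x => normr_Re_le (u k x)) mu psiS hS uk1 I1.
have B2 := integral_fejerV_hat_le _ _ _ _ c (t - pi / 2) r e r0 e0 mu2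
  (fun x => normr_Im_le (u k x)) mu psiS hS uk1 I2.
rewrite PE normrM (ger0_norm F0) /C mulrDr addrC; apply: lerD.
  by rewrite mulrA.
rewrite mulrCA ler_wpM2l//; apply: le_trans (ler_normB _ _) _.
by apply: le_trans (lerD B1 B2) _; rewrite -/M -splitr.
Qed.

Lemma integrable_phase_Re m phi c t r : 0 < m -> L2r m phi ->
  leb.-integrable setT (EFin \o (fun p => phase_Re phi c t p * fejerV r p)).
Proof.
move=> m0 [mphi phi2].
have [K hK] := integral_tensor_fejer_sqr_lty r (m + 1) (energy m)
  (addr_ge0 (ltW m0) ler01) (measurable_energy m)
  (fun p => energy_gt0 m p m0) (fun p => energy_le m p m0).
have rn0 : (0 <= rnorm m phi)%E by exact: poweR_ge0.
have fin : rnorm m phi \is a fin_num by rewrite ge0_fin_numE.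
pose e := fine (rnorm m phi) + 1.
have e0 : 0 < e by rewrite ltr_wpDl// fine_ge0.
have le : (rnorm m phi <= e%:E)%E by rewrite EFinD fineK// leeDl.
by have [] := pairing_bound _ _ c t (energy m) _ _ mphi
  (measurable_tensor_fejer n r) (measurable_energy m)
  (fun p => energy_gt0 m p m0) e0 (rnorm_le _ _ _ (ltW e0) le) hK.
Qed.

Lemma pairing_Hspace0 m S phi c t r : 0 < m -> 0 <= r -> Hspace m S phi ->
  (forall x, S x -> exists i, r <= `|(c - x) ord0 i|) ->
  pairing phi (fejerV r) c t = 0.
Proof.
move=> m0 r0 [phi2 phiS] hS.
have Iphi := integrable_phase_Re _ _ c t r m0 phi2.
have [mphi _] := phi2.
have E0 p : 0 < energy m p by exact: energy_gt0.
have [K hK] := integral_tensor_fejer_sqr_lty r (m + 1) (energy m)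
  (addr_ge0 (ltW m0) ler01) (measurable_energy m) E0 (fun p => energy_le m p m0).
have K0 : 0 <= K.
  rewrite -lee_fin (le_trans _ hK)//; apply: integral_ge0 => p _.
  by rewrite lee_fin mulr_ge0 ?sqr_ge0// ltW.
apply/eqP; rewrite -normr_eq0; apply/negPn/negP => N0.
have P0 : 0 < `|pairing phi (fejerV r) c t| by rewrite lt_neqAle eq_sym N0/=.
(* For this [e], [pairing_bound] makes the pairing at most half of itself in absolute value. *)
pose e := `|pairing phi (fejerV r) c t| / (1 + K).
have e0 : 0 < e by rewrite divr_gt0// ltr_pwDl.
have [chi [psi psiS ft] lt] := phiS e e0.
have mchi : cmeasurable chi by case: ft => _ [].
have [ID BD] := pairing_bound _ _ c t (energy m) _ _ (cmeasurableB _ _ mphi mchi)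
    (measurable_tensor_fejer n r) (measurable_energy m) E0 e0
    (rnorm_le _ _ _ (ltW e0) (ltW lt)) hK.
have PD : pairing phi (fejerV r) c t =
    pairing (fun p => phi p - chi p) (fejerV r) c t.
  have chi0 := pairing_is_fourier0 _ _ _ c t r r0 psiS ft hS.
  rewrite -[LHS]subr0 -chi0 -pairingB//.
  have -> : (fun p => phase_Re chi c t p * fejerV r p) = (fun p =>
      phase_Re phi c t p * fejerV r p -
      phase_Re (fun p => phi p - chi p) c t p * fejerV r p).
    by apply/funext => p; rewrite phase_ReB -mulrBl; congr (_ * _); ring.
  exact: (integrableB measurableT Iphi ID).
move: BD; rewrite -PD /e divfK ?gt_eqF ?ltr_pwDl//; lra.
Qed.

End duality.

(** * From pairings at scale r to pairings at scale 2r, and nested cubes *)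

Section bisection.
Context {R : realType} {n : nat}.
Local Notation Rn := 'rV[R]_n.
Local Notation leb := (@lebesgue_rV R n).
Implicit Types (phi : Rn -> R[i]) (m r t e : R) (c x y p : Rn) (S : set Rn).
Local Notation fejerV r := (tensor n (fejer r)).

Lemma tensor_fejer_double r p :
  fejerV (2 * r) p = \prod_i (2 + 2 * cos (r * p ord0 i)) * fejerV r p.
Proof. by rewrite /tensor -big_split/=; apply: eq_bigr => i _; exact: fejer_double. Qed.

Lemma dotprodD_delta c p r i : dotprod (c + r *: delta_mx ord0 i) p = dotprod c p + r * p ord0 i.
Proof.
rewrite /dotprod (eq_bigr (fun j => c ord0 j * p ord0 j +
    r * ((j == i)%:R * p ord0 j))); last first.
  by move=> j _; rewrite !mxE eqxx/= mulrDl mulrA.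
rewrite big_split/=; congr (_ + _); rewrite -mulr_sumr; congr (_ * _).
rewrite (bigD1 i)//= eqxx mul1r big1 ?addr0// => j ji.
by rewrite (negbTE ji) mul0r.
Qed.

(** One coordinate is treated at a time: 2 cos (r p_j) times the phase centered at c is the sum of
    the phases centered at c + r e_j and c - r e_j. As s has no repetition, each coordinate is
    shifted at most once, which keeps all final centers within r of c in the sup norm. *)
Lemma pairing_halving_seq phi t r (s : seq 'I_n) : uniq s -> 0 <= r ->
  (forall c, leb.-integrable setT (EFin \o (fun p => phase_Re phi c t p * fejerV r p))) ->
  forall c,
  (forall c', (forall i, i \notin s -> c' ord0 i = c ord0 i) ->
    (forall i, `|c' ord0 i - c ord0 i| <= r) -> pairing phi (fejerV r) c' t = 0) ->
  pairing phi (fun p => \prod_(i <- s) (2 + 2 * cos (r * p ord0 i)) * fejerV r p) c t = 0.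
Proof.
move=> + r0 I; elim: s => [_ c H|j s IHs /= /andP[js us] c H].
  rewrite /pairing; under eq_Rintegral do rewrite big_nil mul1r.
  by apply: H => // i; rewrite subrr normr0.
pose G := fun p : Rn => \prod_(i <- s) (2 + 2 * cos (r * p ord0 i)).
have IG c' : leb.-integrable setT
    (EFin \o (fun p => phase_Re phi c' t p * (G p * fejerV r p))).
  have mG : measurable_fun setT G.
    apply: measurable_prod => i _; apply: measurable_funD => //.
    apply: measurable_funM => //; apply: (measurableT_comp measurable_cos).
    by apply: measurable_funM => //; exact: measurable_coord.
  have GM p : `|G p| <= \prod_(i <- s) 4.
    rewrite normr_prod; apply: ler_prod => i _; rewrite normr_ge0/=.
    have := cos_max (r * p ord0 i); rewrite ler_norml => /andP[? ?].
    by rewrite ler_norml; apply/andP; split; lra.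
  apply: eq_integrable (integrableM_bounded (I c') mG GM) => // p _ /=.
  by rewrite -mulrA [fejerV r p * _]mulrC.
pose cp := c + r *: delta_mx ord0 j; pose cm := c + (- r) *: delta_mx ord0 j.
have H0 c' : c' ord0 =1 (c + (c' ord0 j - c ord0 j) *: delta_mx ord0 j) ord0 ->
    `|c' ord0 j - c ord0 j| <= r ->
    pairing phi (fun p => G p * fejerV r p) c' t = 0.
  move=> c'E c'r; apply: IHs => // c2 c2E c2r; apply: H => i.
    rewrite inE negb_or => /andP[ij si]; rewrite c2E// c'E !mxE (negbTE ij) andbF.
    by rewrite mulr0 addr0.
  have [->|ij] := eqVneq i j; first by rewrite c2E.
  suff <- : c' ord0 i = c ord0 i by exact: c2r.
  by rewrite c'E !mxE (negbTE ij) andbF mulr0 addr0.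
have Hc : pairing phi (fun p => G p * fejerV r p) c t = 0.
  by apply: H0; rewrite subrr ?normr0// scale0r addr0.
have E a : (c + a *: delta_mx ord0 j) ord0 j - c ord0 j = a.
  by rewrite !mxE !eqxx/= mulr1 addrC addKr.
have Hp : pairing phi (fun p => G p * fejerV r p) cp t = 0.
  by apply: H0; rewrite E// ger0_norm.
have Hm : pairing phi (fun p => G p * fejerV r p) cm t = 0.
  by apply: H0; rewrite E// normrN ger0_norm.
have -> : pairing phi (fun p => \prod_(i <- j :: s) (2 + 2 * cos (r * p ord0 i)) *
    fejerV r p) c t = \int[leb]_p (2 * (phase_Re phi c t p * (G p * fejerV r p)) +
    (phase_Re phi cp t p * (G p * fejerV r p) + phase_Re phi cm t p * (G p * fejerV r p))).
  apply: eq_Rintegral => p _; rewrite big_cons -/(G p).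
  rewrite /phase_Re /cp /cm !dotprodD_delta mulNr.
  rewrite (addrAC _ _ t) (addrAC _ (- _) t).
  move: (dotprod c p + t) => b; rewrite cosB sinB cosD sinD; ring.
rewrite RintegralD//; last 2 first.
- exact: (integrableZl measurableT 2 (IG c)).
- exact: (integrableD measurableT (IG cp) (IG cm)).
rewrite RintegralZl// RintegralD// -!/(pairing _ _ _ _).
by rewrite Hc Hp Hm mulr0 !addr0.
Qed.

Lemma pairing_halving phi c t r : 0 <= r ->
  (forall c, leb.-integrable setT (EFin \o (fun p => phase_Re phi c t p * fejerV r p))) ->
  (forall c', (forall i, `|c' ord0 i - c ord0 i| <= r) -> pairing phi (fejerV r) c' t = 0) ->
  pairing phi (fejerV (2 * r)) c t = 0.
Proof.
move=> r0 I H; rewrite (_ : fejerV (2 * r) = fun p =>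
    \prod_i (2 + 2 * cos (r * p ord0 i)) * fejerV r p); last first.
  by apply/funext => p; exact: tensor_fejer_double.
apply: pairing_halving_seq => //; first exact: index_enum_uniq.
by move=> c' _; exact: H.
Qed.

(** Balls of the topology on row vectors are sup-norm balls, so a ball around x that avoids S is
    already a coordinatewise gap. *)
Lemma notin_closed_gap S x : closed S -> ~ S x ->
  exists2 e, 0 < e & forall y, S y -> exists i, e <= `|(x - y) ord0 i|.
Proof.
move=> cS Sx; have : nbhs x (~` S) by apply: open_nbhs_nbhs; split => //; exact: closed_openC.
rewrite -nbhs_ballE => -[e /= e0 xe]; exists e => // y Sy.
apply: contrapT => h; apply: (xe y) => //; split=> // i j; rewrite (ord1 i) /=.
rewrite /ball/= ltNge; apply/negP => ej; apply: h; exists j.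
by rewrite !mxE in ej *.
Qed.

Lemma exists_halving_lt r e : 0 <= r -> 0 < e -> exists k, r / 2 ^+ k <= e.
Proof.
move=> r0 e0; have [k kr] : exists k, r / e < k%:R.
  by exists (Num.bound (r / e)); apply: archi_boundP; rewrite divr_ge0// ltW.
exists k; rewrite ler_pdivrMr ?exprn_gt0// mulrC -ler_pdivrMr//.
apply: (le_trans (ltW kr)); rewrite -natrX ler_nat ltnW//; exact: ltn_expl.
Qed.

(* Bisection: a nonzero pairing at scale [r] would propagate to a sequence of
   shrinking cubes, whose limit point lies outside [S] or outside [T]. *)
Lemma pairing_disjoint0 m S (T : set Rn) phi c t r : 0 < m -> 0 <= r ->
  closed S -> closed T -> S `&` T = set0 -> Hspace m S phi -> Hspace m T phi ->
  pairing phi (fejerV r) c t = 0.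
Proof.
move=> m0 r0 cS cT ST0 phiS phiT; apply: contrapT => N0.
have phi2 : L2r m phi by case: phiS.
pose P x s := pairing phi (fejerV s) x t <> 0.
(* The assumptions stand under the existential so that choice yields a total function [f]. *)
have step x (s : R) : exists y, 0 <= s -> P x s ->
    (forall i, `|y ord0 i - x ord0 i| <= s / 2) /\ P y (s / 2).
  apply: contrapT => h; have [s0 Ps] : 0 <= s /\ P x s.
    by apply: contrapT => h'; apply: h; exists x => s0 Ps; case: h'.
  apply: Ps; rewrite (_ : s = 2 * (s / 2)); last by rewrite mulrC divfK.
  apply: pairing_halving.
  - by rewrite divr_ge0.
  - by move=> c'; exact: (integrable_phase_Re m).
  by move=> y yx; apply: contrapT => Py; apply: h; exists y.
pose f x s := projT1 (cid (step x s)).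
have fP x (s : R) : 0 <= s -> P x s ->
    (forall i, `|f x s ord0 i - x ord0 i| <= s / 2) /\ P (f x s) (s / 2).
  by rewrite /f; case: cid.
pose rk k := r / 2 ^+ k.
have rk0 k : 0 <= rk k by rewrite divr_ge0// exprn_ge0.
have rkS k : rk k.+1 = rk k / 2 by rewrite /rk exprSr invfM mulrA.
pose ck := fix ck k := if k is k'.+1 then f (ck k') (rk k') else c.
have Pk k : P (ck k) (rk k).
  elim: k => [|k IHk]; first by rewrite /rk expr0 divr1.
  by rewrite rkS; exact: (fP _ _ (rk0 k) IHk).2.
have ckS k i : `|ck k.+1 ord0 i - ck k ord0 i| <= rk k.+1.
  by rewrite rkS; exact: (fP _ _ (rk0 k) (Pk k)).1.
(* The radius halves and the center moves by at most the new radius, so the intervals [a i k, b i k]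
   are nested; the supremum of the left ends lies in all of them. *)
pose a i k := ck k ord0 i - rk k; pose b i k := ck k ord0 i + rk k.
have aS i k : a i k <= a i k.+1.
  by have := ckS k i; rewrite ler_norml /a => /andP[+ _]; have := rkS k; lra.
have bS i k : b i k.+1 <= b i k.
  by have := ckS k i; rewrite ler_norml /b => /andP[_]; have := rkS k; lra.
have ab i j k : a i j <= b i k.
  have ab0 l : a i l <= b i l by have := rk0 l; rewrite /a /b; lra.
  have [jk|/ltnW kj] := leqP j k.
    by apply: le_trans (ab0 k); exact: ((nondecreasing_seqP (a i)).1 (aS i)).
  by apply: le_trans (ab0 j) _; exact: ((nonincreasing_seqP (b i)).1 (bS i)).
have [z zk] : exists z : Rn, forall k i, `|z ord0 i - ck k ord0 i| <= rk k.
  exists (\row_i sup (range (a i))) => k i.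
  have hs : has_sup (range (a i)).
    split; first by exists (a i 0); exists 0%N.
    by exists (b i 0) => _ [j _ <-]; exact: ab.
  have h1 : a i k <= sup (range (a i)) by apply: sup_upper_bound => //; exists k.
  have h2 : sup (range (a i)) <= b i k.
    apply: ge_sup; first by exists (a i 0); exists 0%N.
    by move=> _ [j _ <-]; exact: ab.
  by rewrite mxE ler_norml; apply/andP; split; move: h1 h2; rewrite /a /b; lra.
suff main Z : closed Z -> Hspace m Z phi -> ~ Z z -> False.
  have [Sz|/main] := pselect (S z); last exact.
  apply: (main T) => // Tz; have : (S `&` T) z by split.
  by rewrite ST0.
move=> cZ phiZ Zz; have [e e0 eZ] := notin_closed_gap Z z cZ Zz.
(* A point of Z differs from z by at least e in some coordinate, and the k-th center is within e/2
   of z, so the point is still at least e/2, hence at least the k-th radius, away from that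
   center. *)
have [k ke] := exists_halving_lt r (e / 2) r0 ltac:(by rewrite divr_gt0).
apply: (Pk k); apply: (pairing_Hspace0 m Z) => // x /eZ[i ei]; exists i.
have := zk k i; move: ke ei; rewrite !mxE -/(rk k) => ke ei.
have := ler_normD (z ord0 i - ck k ord0 i) (ck k ord0 i - x ord0 i).
rewrite addrA subrK; lra.
Qed.

End bisection.

(** * Measurable indicators from trigonometric functions, and uniqueness for Fourier transforms of
    integrable functions *)

Section trigonometric_closure.
Context {R : realType} {n : nat}.
Local Notation Rn := 'rV[R]_n.
Local Notation leb := (@lebesgue_rV R n).
Implicit Types (f g : Rn -> R) (c p : Rn) (t : R) (A : set Rn).

(** An inductive predicate, so that boundedness, stability under products and vanishing of integrals
    are all proved by induction. The uniform bound in the limit clause is what dominated convergence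
    uses. *)
Inductive trig_closure : (Rn -> R) -> Prop :=
| trig_closure_cos c t : trig_closure (fun p => cos (dotprod c p + t))
| trig_closureD f g : trig_closure f -> trig_closure g ->
    trig_closure (fun p => f p + g p)
| trig_closureZ a f : trig_closure f -> trig_closure (fun p => a * f p)
| trig_closure_lim (u : nat -> Rn -> R) f (M : R) : (forall k, trig_closure (u k)) ->
    (forall k p, `|u k p| <= M) -> (forall p, u k p @[k --> \oo] --> f p) ->
    trig_closure f.

Lemma trig_closure_ext f g : f =1 g -> trig_closure f -> trig_closure g.
Proof. by move=> /funext ->. Qed.

Lemma cvg_norm_le (u : nat -> R) (l M : R) : (forall k, `|u k| <= M) ->
  u k @[k --> \oo] --> l -> `|l| <= M.
Proof.
move=> uM ul; have nul : `|u k| @[k --> \oo] --> `|l| by exact: cvg_norm.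
rewrite -(cvg_lim _ nul)//; apply: limr_le; first by apply/cvg_ex; exists `|l|.
exact: nearW.
Qed.

Lemma trig_closure_bounded f : trig_closure f ->
  measurable_fun setT f /\ exists M, forall p, `|f p| <= M.
Proof.
elim => [c t|{}f g _ [mf [M fM]] _ [mg [N gN]]|a {}f _ [mf [M fM]]|u {}f M _ IH uM uf].
- split; first exact: measurable_cos_dotprod.
  by exists 1 => p; exact: cos_max.
- split; first exact: measurable_funD.
  by exists (M + N) => p; rewrite (le_trans (ler_normD _ _))// lerD.
- split; first exact: measurable_funM.
  by exists (`|a| * M) => p; rewrite normrM ler_wpM2l.
- split; last by exists M => p; exact: cvg_norm_le (uf p).
  apply: (measurable_fun_cvg (h := u)) => [k|p _]; last exact: uf.
  exact: (IH k).1.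
Qed.

Lemma trig_closure_cst a : trig_closure (fun=> a).
Proof.
have /(trig_closureZ a) := trig_closure_cos 0 0; apply: trig_closure_ext => p.
rewrite /dotprod big1 ?addr0 ?cos0 ?mulr1// => i _.
by rewrite mxE mul0r.
Qed.

Lemma trig_closureB f g : trig_closure f -> trig_closure g ->
  trig_closure (fun p => f p - g p).
Proof.
move=> tf /(trig_closureZ (-1)) /(trig_closureD _ _ tf).
by apply: trig_closure_ext => p; rewrite mulN1r.
Qed.

(** Two successive inductions: on the right factor when the left one is a cosine, where two cosines
    multiply into a half-sum of cosines, and then on the left factor. *)
Lemma trig_closureM f g : trig_closure f -> trig_closure g ->
  trig_closure (fun p => f p * g p).
Proof.
have cosM c t h : trig_closure h -> trig_closure (fun p => cos (dotprod c p + t) * h p).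
  elim => [c' t'|h1 h2 _ H1 _ H2|a h1 _ H1|u h1 M _ IH uM uh].
  - have /(trig_closureZ 2^-1) := trig_closureD _ _
      (trig_closure_cos (c - c') (t - t')) (trig_closure_cos (c - (- c')) (t + t')).
    apply: trig_closure_ext => p; rewrite !dotprodBl dotprodNl opprK.
    have -> : dotprod c p - dotprod c' p + (t - t') =
      dotprod c p + t - (dotprod c' p + t') by ring.
    have -> : dotprod c p + dotprod c' p + (t + t') =
      dotprod c p + t + (dotprod c' p + t') by ring.
    move: (dotprod c p + t) (dotprod c' p + t') => a b.
    by rewrite cosB cosD; field.
  - by apply: trig_closure_ext (trig_closureD _ _ H1 H2) => p; rewrite mulrDr.
  - by apply: trig_closure_ext (trig_closureZ a _ H1) => p; rewrite mulrCA.
  - apply: (trig_closure_lim _ _ M IH) => [k p|p].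
      by rewrite normrM (le_trans _ (uM k p))// ler_piMl// cos_max.
    by apply: cvgM; [exact: cvg_cst|exact: uh].
move=> + tg; elim => [c t|f1 f2 _ H1 _ H2|a f1 _ H1|u f1 M _ IH uM uf].
- exact: cosM.
- by apply: trig_closure_ext (trig_closureD _ _ H1 H2) => p; rewrite mulrDl.
- by apply: trig_closure_ext (trig_closureZ a _ H1) => p; rewrite mulrA.
- have [_ [N gN]] := trig_closure_bounded _ tg.
  apply: (trig_closure_lim _ _ (M * N) IH) => [k p|p].
    by rewrite normrM ler_pM.
  by apply: cvgM; [exact: uf|exact: cvg_cst].
Qed.

Lemma Rintegral_trig_closure0 (G f : Rn -> R) : leb.-integrable setT (EFin \o G) ->
  (forall c t, \int[leb]_p (G p * cos (dotprod c p + t)) = 0) ->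
  trig_closure f -> \int[leb]_p (G p * f p) = 0.
Proof.
move=> iG G0.
have I h : trig_closure h -> leb.-integrable setT (EFin \o (fun p => G p * h p)).
  by move=> /trig_closure_bounded[mh [M hM]]; exact: integrableM_bounded iG mh hM.
elim => [//|h1 h2 t1 H1 t2 H2|a h t1 H|u h M tu IH uM uh].
- under eq_Rintegral do rewrite mulrDr.
  by rewrite RintegralD// ?H1 ?H2 ?addr0//; exact: I.
- under eq_Rintegral do rewrite mulrCA.
  by rewrite RintegralZl ?H ?mulr0//; exact: I.
- have th := trig_closure_lim _ _ _ tu uM uh.
  have iM : leb.-integrable setT (fun p => (M%:E * `|(EFin \o G) p|)%E).
    exact/integrableZl/integrable_abse.
  have cv p : setT p -> (G p * u k p)%:E @[k --> \oo] --> (G p * h p)%:E.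
    move=> _; apply: cvg_EFin; first by apply: nearW.
    by apply: cvgM; [exact: cvg_cst|exact: uh].
  have le p k : setT p -> (`|(G p * u k p)%:E| <= M%:E * `|(EFin \o G) p|)%E.
    by move=> _; rewrite /= lee_fin normrM mulrC ler_wpM2r.
  have [_ _] := @dominated_convergence _ _ _ leb setT measurableT
    (fun k p => (G p * u k p)%:E) (fun p => (G p * h p)%:E) _
    (fun k => measurable_int _ (I _ (tu k))) (measurable_int _ (I _ th))
    (aeW _ cv) iM (aeW _ le).
  rewrite (_ : [sequence _]_ _ = cst 0%E); last first.
    by apply/funext => k /=; rewrite (integral_EFin (I _ (tu k))) IH.
  by move=> H; rewrite /Rintegral -(cvg_lim _ H)// lim_cst.
Qed.

(* Newton-Schulz iteration for the sign function on [-1, 1]. *)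
Fixpoint newton_schulz k (z : R) : R :=
  if k is k'.+1 then
    let y := newton_schulz k' z in y * (3 - y ^+ 2) / 2
  else z.

Lemma newton_schulzN k (z : R) : newton_schulz k (- z) = - newton_schulz k z.
Proof. by elim: k => //= k ->; rewrite sqrrN; ring. Qed.

Lemma newton_schulz0 k : newton_schulz k 0 = 0.
Proof. by elim: k => //= k ->; rewrite !mul0r. Qed.

(** One step takes the error 1 - y to (1 - y)^2 (2 + y) / 2. Since the iterates stay above z, (1 -
    y) (2 + y) / 2 is at most 1 - z / 2, so the error decays geometrically. *)
Lemma newton_schulz_gt0 k (z : R) : 0 < z <= 1 ->
  z <= newton_schulz k z <= 1 /\ 1 - newton_schulz k z <= (1 - z / 2) ^+ k.
Proof.
move=> /andP[z0 z1]; elim: k => [|k [/andP[zy y1] IH]] /=.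
  by rewrite lexx z1 expr0; split => //; lra.
set y := newton_schulz k z in zy y1 IH *.
have y0 : 0 < y by exact: lt_le_trans zy.
have E : 1 - y * (3 - y ^+ 2) / 2 = (1 - y) * ((1 - y) * (2 + y) / 2) by field.
have h1 : 0 <= (1 - y) * (2 + y) / 2 <= 1 - z / 2.
  apply/andP; split; first by rewrite divr_ge0// mulr_ge0; lra.
  by nra.
have h2 : 1 - y * (3 - y ^+ 2) / 2 <= (1 - y) * (1 - z / 2).
  by rewrite E ler_wpM2l ?subr_ge0//; case/andP: h1.
have h3 : 0 <= 1 - y * (3 - y ^+ 2) / 2.
  by rewrite E mulr_ge0 ?subr_ge0//; case/andP: h1.
split.
  apply/andP; split; last lra.
  by apply: (le_trans zy); rewrite -subr_ge0; nra.
by rewrite [leRHS]exprSr (le_trans h2)// ler_wpM2r//; lra.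
Qed.

Lemma newton_schulz_norm k (z : R) : `|z| <= 1 -> `|newton_schulz k z| <= 1.
Proof.
have P (y : R) : 0 < y <= 1 -> `|newton_schulz k y| <= 1.
  move=> y01; have [/andP[h1 h2] _] := newton_schulz_gt0 k y y01.
  by rewrite ger0_norm// (le_trans _ h1)//; case/andP: y01 => /ltW.
have [z0|z0|->] := ltgtP z 0; last by rewrite newton_schulz0 normr0.
  by rewrite ltr0_norm// => z1; rewrite -normrN -newton_schulzN P// z1 oppr_gt0 z0.
by rewrite gtr0_norm// => z1; rewrite P// z0.
Qed.

Lemma cvg_newton_schulz (z : R) : `|z| <= 1 ->
  newton_schulz k z @[k --> \oo] --> Num.sg z.
Proof.
have P (y : R) : 0 < y <= 1 -> newton_schulz k y @[k --> \oo] --> (1 : R).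
  move=> y01; have [y0 y1] := andP y01.
  apply: (@squeeze_cvgr _ _ _ _ (fun k => 1 - (1 - y / 2) ^+ k) (fun=> 1)).
  - apply: nearW => k; have [/andP[h1 h2] h3] := newton_schulz_gt0 k y y01.
    by apply/andP; split; lra.
  - rewrite -[X in _ --> X]subr0; apply: cvgB; first exact: cvg_cst.
    by apply: cvg_expr; rewrite ger0_norm; lra.
  - exact: cvg_cst.
have [z0|z0|->] := ltgtP z 0.
- rewrite ltr0_norm// ltr0_sg// => z1.
  rewrite (_ : newton_schulz^~ z = fun k => - newton_schulz k (- z)); last first.
    by apply/funext => k; rewrite newton_schulzN opprK.
  by apply: cvgN; apply: P; rewrite z1 oppr_gt0 z0.
- by rewrite gtr0_norm// gtr0_sg// => z1; apply: P; rewrite z0.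
- rewrite sgr0 => _; rewrite (_ : newton_schulz^~ 0 = cst 0); first exact: cvg_cst.
  by apply/funext => k; rewrite newton_schulz0.
Qed.

Lemma trig_closure_newton_schulz f k : trig_closure f ->
  trig_closure (fun p => newton_schulz k (f p)).
Proof.
move=> tf; elim: k => [//|k IH] /=.
have /(trig_closureZ 2^-1) := trig_closureM _ _ IH
  (trig_closureB _ _ (trig_closure_cst 3) (trig_closureM _ _ IH IH)).
by apply: trig_closure_ext => p; rewrite expr2 mulrC.
Qed.

(** Each iterate is a polynomial in f, and all of them are bounded by 1. *)
Lemma trig_closure_sg f : trig_closure f -> (forall p, `|f p| <= 1) ->
  trig_closure (fun p => Num.sg (f p)).
Proof.
move=> tf f1; apply: (trig_closure_lim (fun k p => newton_schulz k (f p)) _ 1).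
- by move=> k; exact: trig_closure_newton_schulz.
- by move=> k p; exact: newton_schulz_norm.
- by move=> p; exact: cvg_newton_schulz.
Qed.

Lemma sgr_sin (x : R) : `|x| <= 1 -> Num.sg (sin x) = Num.sg x.
Proof.
have pi1 : (1 : R) < pi by have := pi_ge2 R; lra.
have [x0|x0|->] := ltgtP x 0; last by rewrite sin0.
  rewrite ltr0_norm// => x1; rewrite (ltr0_sg x0) -[x]opprK sinN sgrN gtr0_sg//.
  by apply: sin_gt0_pi; lra.
by rewrite gtr0_norm// => x1; rewrite !gtr0_sg//; apply: sin_gt0_pi; lra.
Qed.

(** A coordinate is unbounded, hence not itself in the closure. But sin ((p_i - a) / (k + 1)) is
    bounded, and at each p it has the sign of p_i - a as soon as the angle is at most 1 in absolute
    value. *)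
Lemma trig_closure_sg_coord i (a : R) :
  trig_closure (fun p : Rn => Num.sg (p ord0 i - a)).
Proof.
pose h k (p : Rn) := sin (k.+1%:R^-1 * (p ord0 i - a)).
have th k : trig_closure (h k).
  apply: trig_closure_ext (trig_closure_cos (0 + k.+1%:R^-1 *: delta_mx ord0 i)
    (- (k.+1%:R^-1 * a) - pi / 2)) => p.
  rewrite dotprodD_delta /h addrA cosBpihalf; congr (sin _).
  by rewrite {1}/dotprod big1 ?add0r ?mulrBr// => j _; rewrite mxE mul0r.
apply: (trig_closure_lim (fun k p => Num.sg (h k p)) _ 1).
- by move=> k; apply: trig_closure_sg => // p; exact: sin_max.
- by move=> k p; rewrite normr_sg; case: (_ != 0); rewrite ?normr1 ?normr0 ?ler01.
- move=> p; apply: cvg_near_cst.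
  near=> k; rewrite sgr_sin.
    by rewrite sgrM gtr0_sg ?invr_gt0// mul1r.
  rewrite normrM ger0_norm ?invr_ge0// mulrC ler_pdivrMr// mul1r.
  have : `|p ord0 i - a| <= k%:R by near: k; exact: nbhs_infty_ger.
  by move=> /le_trans -> //; rewrite ler_nat.
Unshelve. all: by end_near. Qed.

(** The polynomial (s^2 + s) / 2 takes the values 1, 0, 0 at s = 1, 0, -1. *)
Lemma trig_closure_indic_gt i (a : R) :
  trig_closure (\1_[set p : Rn | a < p ord0 i]).
Proof.
have ts := trig_closure_sg_coord i a.
have /(trig_closureZ 2^-1) := trig_closureD _ _ (trig_closureM _ _ ts ts) ts.
apply: trig_closure_ext => p; rewrite indicE.
have [pa|pa] := pselect (a < p ord0 i).
  by rewrite mem_set// gtr0_sg ?subr_gt0// mulr1 mulVf.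
rewrite memNset//; move/negP: pa; rewrite -leNgt le_eqVlt => /predU1P[->|pa].
  by rewrite subrr sgr0 mulr0 addr0 mulr0.
by rewrite ltr0_sg ?subr_lt0// mulrNN mulr1 subrr mulr0.
Qed.

Lemma trig_closure_indicC A : trig_closure \1_A -> trig_closure \1_(~` A).
Proof.
move=> tA; apply: trig_closure_ext (trig_closureB _ _ (trig_closure_cst 1) tA) => p.
by rewrite !indicE in_setC; case: (_ \in _); rewrite ?subrr ?subr0.
Qed.

Lemma trig_closure_indicU A B : trig_closure \1_A -> trig_closure \1_B ->
  trig_closure \1_(A `|` B).
Proof.
move=> /trig_closure_indicC tA /trig_closure_indicC tB; rewrite -[_ `|` _]setCK.
apply: trig_closure_indicC; rewrite setCU.
apply: trig_closure_ext (trig_closureM _ _ tA tB) => p.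
by rewrite !indicE in_setI; case: (_ \in _); case: (_ \in _); rewrite ?mulr1 ?mulr0.
Qed.

Lemma trig_closure_indic0 : trig_closure \1_set0.
Proof. by apply: trig_closure_ext (trig_closure_cst 0) => p; rewrite indicE in_set0. Qed.

Lemma trig_closure_indic_bigcup (F : (set Rn)^nat) :
  (forall k, trig_closure \1_(F k)) -> trig_closure \1_(\bigcup_k F k).
Proof.
move=> tF; apply: (trig_closure_lim (fun k => \1_(\big[setU/set0]_(i < k) F i)) _ 1).
- elim=> [|k IHk]; first by rewrite big_ord0; exact: trig_closure_indic0.
  by rewrite big_ord_recr; exact: trig_closure_indicU.
- by move=> k p; rewrite indicE; case: (_ \in _); rewrite ?normr1 ?normr0 ?ler01.
- move=> p; apply: cvg_near_cst; rewrite !indicE.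
  have [[j _ Fj]|nF] := pselect ((\bigcup_k F k) p).
    near=> k; rewrite !indicE !mem_set//; first by exists j.
    rewrite -bigcup_mkord; exists j => //=; near: k; exact: nbhs_infty_gt.
  near=> k; rewrite !indicE !memNset//.
  by rewrite -bigcup_mkord => -[j _ Fj]; apply: nF; exists j.
Unshelve. all: by end_near. Qed.

(** The sets whose preimage has its indicator in the closure form a sigma-algebra. This is applied
    twice: with f = id to the cylinders generating the sigma-algebra of R^n, and with f a coordinate
    to the rays generating the Borel sets of R. *)
Lemma trig_closure_indic A : measurable A -> trig_closure \1_A.
Proof.
have sigma d (T : measurableType d) (f : Rn -> T) (G : set (set T)) :
    (forall B, G B -> trig_closure \1_(f @^-1` B)) ->
    <<s G >> `<=` [set B | trig_closure \1_(f @^-1` B)].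
  move=> GP; apply: smallest_sub => //; split => /=.
  - by rewrite preimage_set0; exact: trig_closure_indic0.
  - by move=> B tB; rewrite setTD preimage_setC; exact: trig_closure_indicC.
  - by move=> F tF; rewrite preimage_bigcup; exact: trig_closure_indic_bigcup.
suff : g_sigma_preimage (fun (i : 'I_n) (v : Rn) => v ord0 i) `<=`
    [set B | trig_closure \1_(id @^-1` B)] by apply.
apply: (sigma _ _ id) => B; rewrite -bigcup_seq/= => -[i _ [C mC <-]].
rewrite setTI preimage_id.
have mC' : (@RGenOInfty.G R).-sigma.-measurable C.
  by rewrite -RGenOInfty.measurableE.
apply: (sigma _ _ (fun v : Rn => v ord0 i) _ _ C mC') => _ [a ->].
rewrite (_ : _ @^-1` _ = [set p : Rn | a < p ord0 i]).
  exact: trig_closure_indic_gt.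
by apply/seteqP; split => p /=; rewrite in_itv/= andbT.
Qed.

Lemma ae_eq0_of_cos (G : Rn -> R) : leb.-integrable setT (EFin \o G) ->
  (forall c t, \int[leb]_p (G p * cos (dotprod c p + t)) = 0) ->
  {ae leb, forall p, G p = 0}.
Proof.
move=> iG G0; have : ae_eq leb setT (EFin \o G) (cst 0%E).
  apply: integral_ae_eq => // A _ mA; rewrite integral0 integral_mkcond.
  have -> : (EFin \o G) \_ A = EFin \o (fun p => G p * \1_A p).
    by apply/funext => p; rewrite patchE /= indicE; case: (_ \in _); rewrite ?mulr1 ?mulr0.
  have iGA : leb.-integrable setT (EFin \o (fun p => G p * \1_A p)).
    have [mA1 [M MA]] := trig_closure_bounded _ (trig_closure_indic _ mA).
    exact: (integrableM_bounded iG mA1 MA).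
  rewrite (integral_EFin iGA) Rintegral_trig_closure0//.
  exact: trig_closure_indic.
by apply: filterS => p /(_ I) [].
Qed.

End trigonometric_closure.

(** * Recovery of phi from its pairings, and the reverse inclusion *)

Section main.
Context {R : realType} {n : nat}.
Local Notation Rn := 'rV[R]_n.
Local Notation leb := (@lebesgue_rV R n).
Implicit Types (phi : Rn -> R[i]) (m r t : R) (c p : Rn) (S T : set Rn).
Local Notation fejerV r := (tensor n (fejer r)).

(** The zeros of the kernel are the nonzero multiples of 2 pi / r. At x = 0 positivity comes from
    the value r^2 / 2 added to the raw quotient. *)
Lemma fejer_gt0 r (x : R) : 0 < r -> `|r * x| <= 1 -> 0 < fejer r x.
Proof.
move=> r0 rx; rewrite lt_neqAle fejer_ge0 andbT eq_sym.
have [->|x0] := eqVneq x 0.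
  by rewrite fejer_at0 mulf_neq0 ?invr_eq0// expf_neq0// gt_eqF.
rewrite fejer_neq0// mulf_neq0 ?invr_eq0 ?expf_neq0//.
rewrite onemcos mulf_neq0// expf_neq0// -sgr_eq0 sgr_sin.
  by rewrite sgr_eq0 mulf_neq0 ?invr_eq0// mulf_neq0// gt_eqF.
by rewrite normrM normfV (gtr0_norm (ltr0n _ 2)) ler_pdivrMr//; lra.
Qed.

(** Averaging over (c, t) and (-c, -t) cancels the sines and isolates Re phi; a further phase of -
    pi / 2 isolates Im phi. A single kernel has zeros, so countably many scales 1 / (k + 1) are
    used: each point has one at which the kernel is positive. *)
Lemma ae_eq0_of_pairing phi :
  (forall c t r, 0 <= r ->
    leb.-integrable setT (EFin \o (fun p => phase_Re phi c t p * fejerV r p))) ->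
  (forall c t r, 0 <= r -> pairing phi (fejerV r) c t = 0) ->
  {ae leb, forall p, phi p = 0}.
Proof.
move=> I P0; pose r k : R := k.+1%:R^-1.
have r0 k : 0 <= r k by rewrite invr_ge0.
have S c t s h k (F : Rn -> R) : (forall p, F p = 
    2^-1 * (phase_Re phi c t p * fejerV (r k) p + phase_Re phi s h p * fejerV (r k) p)) ->
    leb.-integrable setT (EFin \o F) /\ \int[leb]_p F p = 0.
  move=> FE; have ID := integrableD measurableT (I c t _ (r0 k)) (I s h _ (r0 k)).
  split.
    by apply: eq_integrable (integrableZl measurableT 2^-1 ID) => // p _ /=; rewrite FE.
  under eq_Rintegral do rewrite FE.
  by rewrite RintegralZl// RintegralD ?(I _ _ _ (r0 k))// -!/(pairing _ _ _ _) !P0// addr0 mulr0.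
have cosE c t p : cos (dotprod (- c) p - t) = cos (dotprod c p + t).
  by rewrite dotprodNl -opprD cosN.
have sinE c t p : sin (dotprod (- c) p - t) = - sin (dotprod c p + t).
  by rewrite dotprodNl -opprD sinN.
have ReE k c t p : complex.Re (phi p) * fejerV (r k) p * cos (dotprod c p + t) =
    2^-1 * (phase_Re phi c t p * fejerV (r k) p +
            phase_Re phi (- c) (- t) p * fejerV (r k) p).
  by rewrite /phase_Re cosE sinE; field.
have ImE k c t p : complex.Im (phi p) * fejerV (r k) p * cos (dotprod c p + t) =
    2^-1 * (phase_Re phi c (t - pi / 2) p * fejerV (r k) p +
            phase_Re phi (- c) (- t - pi / 2) p * fejerV (r k) p).
  by rewrite /phase_Re !addrA !cosBpihalf !sinBpihalf cosE sinE; field.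
have one p : cos (dotprod 0 p + 0) = 1.
  by rewrite /dotprod big1 ?addr0 ?cos0// => i _; rewrite mxE mul0r.
have Re0 k : {ae leb, forall p, complex.Re (phi p) * fejerV (r k) p = 0}.
  apply: ae_eq0_of_cos => [|c t]; last exact: (S _ _ _ _ _ _ (ReE k c t)).2.
  (* At c = 0 and t = 0 the cosine is 1, so integrability of the product with the cosine is that of
     Re phi times the kernel. *)
  apply: (S 0 0 (- 0) (- 0) k _ _).1 => p.
  by rewrite -ReE one mulr1.
have Im0 k : {ae leb, forall p, complex.Im (phi p) * fejerV (r k) p = 0}.
  apply: ae_eq0_of_cos => [|c t]; last exact: (S _ _ _ _ _ _ (ImE k c t)).2.
  apply: (S 0 (0 - pi / 2) (- 0) (- 0 - pi / 2) k _ _).1 => p.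
  by rewrite -ImE one mulr1.
have /ae_foralln AR := Re0; have /ae_foralln AI := Im0.
apply: filterS2 AR AI => p Rp Ip.
have [k kp] : exists k, forall i, `|p ord0 i| <= k.+1%:R.
  have [N NP] : exists N, \sum_i `|p ord0 i| < N%:R.
    by exists (Num.bound (\sum_i `|p ord0 i|)); apply: archi_boundP; exact: sumr_ge0.
  exists N => i; rewrite (@le_trans _ _ N%:R) ?ler_nat// (le_trans _ (ltW NP))//.
  by rewrite (bigD1 i)//= lerDl sumr_ge0.
have w0 : fejerV (r k) p != 0.
  rewrite gt_eqF//; apply: prodr_gt0 => i _; apply: fejer_gt0; first by rewrite invr_gt0.
  by rewrite normrM ger0_norm// mulrC ler_pdivrMr// mul1r.
move: (Rp k) (Ip k) => /eqP; rewrite mulf_eq0 (negbTE w0) orbF => /eqP re0.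
move=> /eqP; rewrite mulf_eq0 (negbTE w0) orbF => /eqP im0.
by case: (phi p) re0 im0 => a b /= -> ->.
Qed.

Lemma Hspace_cap_ae0 m S T phi : 0 < m -> closed S -> closed T -> S `&` T = set0 ->
  Hspace m S phi -> Hspace m T phi -> {ae leb, forall p, phi p = 0}.
Proof.
move=> m0 cS cT ST0 phiS phiT; apply: ae_eq0_of_pairing => c t r r0.
  by apply: (integrable_phase_Re m) => //; case: phiS.
exact: (pairing_disjoint0 m S T).
Qed.

Lemma cmeasurable0 : cmeasurable (fun _ : Rn => 0 : R[i]).
Proof. by split => /=; exact: measurable_cst. Qed.

Lemma cLnorm0 (q : R) (f : Rn -> R[i]) : q != 0 -> (forall p, f p = 0) ->
  cLnorm q f = 0%E.
Proof.
move=> q0 /funext ->; rewrite /cLnorm (_ : EFin \o _ = cst 0%E) ?Lnorm0//.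
by apply/funext => p; congr EFin; exact: Normc.normc0.
Qed.

Lemma rnorm_ae0 m phi : cmeasurable phi -> {ae leb, forall p, phi p = 0} ->
  rnorm m phi = 0%E.
Proof.
move=> mphi phi0; rewrite /rnorm (ae_eq_integral (cst 0%E))//.
- by rewrite integral0 poweR0r// invr_neq0.
- apply/measurable_EFinP/measurable_funM; first exact: measurable_normc_sqr.
  exact: (measurableT_comp measurable_invr (measurable_energy m)).
- apply: filterS phi0 => p -> _; congr EFin.
  by rewrite normc_sqr/= expr0n addr0 mul0r.
Qed.

Lemma is_fourier0 : is_fourier (fun _ : Rn => 0 : R[i]) (fun _ : Rn => 0 : R[i]).
Proof.
have L q : q != 0 -> cLp q (fun _ : Rn => 0 : R[i]).
  by move=> q0; split; [exact: cmeasurable0|rewrite cLnorm0].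
split; [exact: L|exact: L|exists (fun _ _ => 0); split => [k||]].
- by split; exact: L.
- rewrite (_ : (fun _ => _) = cst 0%E); first exact: cvg_cst.
  by apply/funext => k; rewrite cLnorm0// => p; rewrite subrr.
- rewrite (_ : (fun _ => _) = cst 0%E); first exact: cvg_cst.
  apply/funext => k; rewrite cLnorm0// => p; rewrite subr0 fourier_integralE.
  have I0 : \int[leb]_x (0 : R) = 0 by rewrite /Rintegral integral0.
  have -> : fourier_Re (fun _ : Rn => 0 : R[i]) p = 0.
    by rewrite -I0; apply: eq_Rintegral => x _ /=; rewrite !mul0r addr0.
  have -> : fourier_Im (fun _ : Rn => 0 : R[i]) p = 0.
    by rewrite -I0; apply: eq_Rintegral => x _ /=; rewrite !mul0r subr0.
  by rewrite mulr0.
Qed.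

(** Functions are not identified almost everywhere: a null function is approximated by the constant
    0, at distance 0 for the seminorm, and 0 is its own Fourier transform. *)
Lemma zero_class_sub_Hspace m S : zero_class (R := R) (n := n) `<=` Hspace m S.
Proof.
move=> phi [mphi phi0]; have rn0 := rnorm_ae0 m _ mphi phi0.
split; first by split => //; rewrite rn0.
move=> e e0; exists (fun=> 0); last first.
  by rewrite (_ : (fun p => _) = phi) ?rn0//; apply/funext => p; rewrite subr0.
exists (fun=> 0); last exact: is_fourier0.
split; first by case: is_fourier0.
exact: aeW.
Qed.

End main.

Theorem proposition6 (R : realType) (n : nat) (hn : (0 < n)%N)
  (m : R) (hm : 0 < m) (S T : set 'rV[R]_n)
  (hS : closed S) (hT : closed T) (hST : S `&` T = set0) :
  Hspace m S `&` Hspace m T = @zero_class R n.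
Proof.
apply/seteqP; split => [phi [phiS phiT]|phi phi0].
  split; first by case: phiS => -[].
  exact: (Hspace_cap_ae0 m S T).
by split; exact: zero_class_sub_Hspace.
Qed.
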